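(* Let $b>a>0$, $0\leq\rho<\frac12<\theta\leq1$, $s\geq0$ and $\gamma\in(0,1]$. Then there is a constant $C>0$, independent of $t$ and $U_0$, such that for every $U_0\in H^s\cap L^{1,\gamma}$ the solution $U$ of the Cauchy problem $$U_t+\tfrac12B_0(-\Delta)^{\rho}U+iB_1(-\Delta)^{\frac12}U+\tfrac12B_0(-\Delta)^{\theta}U=0\quad (x\in\mathbb{R}^2,\ t>0),\qquad U(0,x)=U_0(x),$$ satisfies, for all $t\geq0$, $$\|U(t,\cdot)\|_{\dot H^s}\leq C(1+t)^{-\frac{s+\gamma}{2-2\rho}-\frac{1}{2-2\rho}}\|U_0\|_{H^s\cap L^{1,\gamma}}+C(1+t)^{-\frac{s}{2-2\rho}-\frac{1}{2-2\rho}}\left|\int_{\mathbb{R}^2}U_0(x)\,dx\right|.$$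
   Context: $U$ and $U_0$ take values in $\mathbb{C}^4$. The coefficient matrices are $$B_0=\begin{pmatrix}1&0&1&0\\0&1&0&1\\1&0&1&0\\0&1&0&1\end{pmatrix},\qquad B_1=\operatorname{diag}(-b,-a,b,a).$$ The solution is given on the Fourier side ($W(t,\xi)$ denotes the Fourier transform of $U(t,\cdot)$ in $x$) by the solution of the ODE system $W_t+\left(\frac12(|\xi|^{2\rho}+|\xi|^{2\theta})B_0+i|\xi|B_1\right)W=0$, $W(0,\xi)=W_0(\xi)$, where $W_0$ is the Fourier transform of $U_0$. $H^s$ and $\dot H^s$ denote the Bessel and Riesz potential spaces on $\mathbb{R}^2$ based on $L^2$, so $\|U\|_{\dot H^s}$ is, up to a constant, $\||\xi|^sW\|_{L^2}$. The weighted space $L^{1,\gamma}$ consists of $f\in L^1$ with $\|f\|_{L^{1,\gamma}}=\int_{\mathbb{R}^2}(1+|x|)^{\gamma}|f(x)|\,dx<\infty$; $\|\cdot\|_{H^s\cap L^{1,\gamma}}=\|\cdot\|_{H^s}+\|\cdot\|_{L^{1,\gamma}}$. *)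

(* Defs.v *)
From HB Require Import structures.
From mathcomp Require Import all_boot all_order all_algebra.
From mathcomp Require Import complex.
From mathcomp Require Import all_classical all_reals all_analysis.

Set Implicit Arguments.
Unset Strict Implicit.
Unset Printing Implicit Defensive.
Import Order.TTheory GRing.Theory Num.Theory.
Import numFieldNormedType.Exports.

Local Open Scope classical_set_scope.
Local Open Scope ring_scope.

Notation plane R := (measurableTypeR R * measurableTypeR R)%type.
Notation leb2 R := (@lebesgue_measure R \x @lebesgue_measure R)%E.
Notation C4 R := ('cV[complex R]_4).

Section Defs.
Context {R : realType}.
Implicit Types (x xi : plane R) (v : C4 R) (f g : plane R -> C4 R).

(* The norm [`|x|] that the library puts on a product is the max norm; all
   norms below are Euclidean. *)
Definition enorm x : R := Num.sqrt (x.1 ^+ 2 + x.2 ^+ 2).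

Definition dotp x xi : R := x.1 * xi.1 + x.2 * xi.2.

Definition cnorm4 v : R :=
  Num.sqrt (\sum_(k < 4) (complex.Re (v k ord0) ^+ 2 + complex.Im (v k ord0) ^+ 2)).

Definition measurable_C4 f : Prop :=
  forall k, measurable_fun setT (fun x => complex.Re (f x k ord0))
         /\ measurable_fun setT (fun x => complex.Im (f x k ord0)).

(* Componentwise Lebesgue integral; meaningful when [f] is integrable on [D]. *)
Definition integral_C4 (D : set (plane R)) f : C4 R :=
  \col_k Complex (\int[leb2 R]_(x in D) complex.Re (f x k ord0))
                 (\int[leb2 R]_(x in D) complex.Im (f x k ord0)).

(* The L^2 norm of the scalar function [w * |f|], with values in [0, +oo]. *)
Definition wL2norm (w : plane R -> R) f : \bar R :=
  (Lnorm (leb2 R) 2%:E (fun x => (w x * cnorm4 (f x))%:E))%E.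

Definition L2_fun f : Prop :=
  measurable_C4 f /\ (wL2norm (fun=> 1%R) f < +oo)%E.

Definition expNi (y : R) : complex R := Complex (cos y) (- sin y).

(* int_(|x| <= n) e^(-i x.xi) f(x) dx; an L^2 function is integrable on balls. *)
Definition trunc_fourier (n : nat) f xi : C4 R :=
  integral_C4 [set x | enorm x <= n%:R] (fun x => expNi (dotp x xi) *: f x).

(* Plancherel's Fourier transform on L^2, as the L^2 limit of the Fourier
   integrals over growing balls. It determines [g] up to a null set. *)
Definition is_fourier f g : Prop :=
  [/\ L2_fun f, L2_fun g &
      wL2norm (fun=> 1%R) (fun xi => trunc_fourier n f xi - g xi)
        @[n --> \oo] --> 0%E].

Definition fourier f : plane R -> C4 R :=
  xget (fun=> 0) [set g | is_fourier f g].

(* s >= 0 here, so that H^s is a subspace of L^2. *)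
Definition Hs_norm (s : R) f : \bar R :=
  wL2norm (fun xi => (1 + enorm xi ^+ 2) `^ (s / 2)) (fourier f).

Definition in_Hs (s : R) f : Prop := L2_fun f /\ (Hs_norm s f < +oo)%E.

Definition dotHs_norm (s : R) f : \bar R :=
  wL2norm (fun xi => enorm xi `^ s) (fourier f).

Definition L1w_norm (gamma : R) f : \bar R :=
  (\int[leb2 R]_x ((1 + enorm x) `^ gamma * cnorm4 (f x))%:E)%E.

Definition in_L1w (gamma : R) f : Prop :=
  measurable_C4 f /\ (L1w_norm gamma f < +oo)%E.

Definition cR (r : R) : complex R := Complex r 0.

Definition B0 : 'M[complex R]_4 :=
  \matrix_(i, j) nth 0 (nth [::] [:: [:: 1; 0; 1; 0];
                                     [:: 0; 1; 0; 1];
                                     [:: 1; 0; 1; 0];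
                                     [:: 0; 1; 0; 1]] i) j.

Definition B1 (a b : R) : 'M[complex R]_4 :=
  diag_mx (\row_j nth 0 [:: cR (- b); cR (- a); cR b; cR a] j).

(* Here [0 `^ 0 = 1]; for rho = 0 this only concerns the point [xi = 0]. *)
Definition symbol (a b rho theta : R) xi : 'M[complex R]_4 :=
  cR (2^-1 * (enorm xi `^ (2 * rho) + enorm xi `^ (2 * theta))) *: B0
  + Complex 0 (enorm xi) *: B1 a b.

(* The ODE y' + A y = 0 for t > 0, with y continuous at t = 0 from the right. *)
Definition solves_ode (A : 'M[complex R]_4) (y : R -> C4 R) : Prop :=
  (forall (t : R) k, 0 < t ->
     is_derive t (1 : R) (fun r => complex.Re (y r k ord0))
       (complex.Re ((- (A *m y t)) k ord0)) /\
     is_derive t (1 : R) (fun r => complex.Im (y r k ord0))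
       (complex.Im ((- (A *m y t)) k ord0))) /\
  (forall k,
     complex.Re (y t k ord0) @[t --> (0 : R)^'+] --> complex.Re (y 0 k ord0) /\
     complex.Im (y t k ord0) @[t --> (0 : R)^'+] --> complex.Im (y 0 k ord0)).

(* The Cauchy problem on the Fourier side: [W t] is the Fourier transform of
   [U t] at every time [t >= 0] (in particular [W 0] is that of [U0]), and
   [W ^~ xi] solves the transformed system at almost every frequency. *)
Definition is_solution (a b rho theta : R) (U0 : plane R -> C4 R)
    (U : R -> plane R -> C4 R) : Prop :=
  {ae leb2 R, forall x, U 0 x = U0 x} /\
  exists W : R -> plane R -> C4 R,
    (forall t : R, 0 <= t -> is_fourier (U t) (W t)) /\
    {ae leb2 R, forall xi, solves_ode (symbol a b rho theta xi) (W ^~ xi)}.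

End Defs.

(* Main.v *)
(** On the pairs (W_1, W_3) and (W_2, W_4) the damping acts only on the sum of
    the two components, and the oscillation couples it to their difference. A
    cross term of weight |xi| / (|xi|^(2 rho) + |xi|^(2 theta)) added to the
    energy gives |W(t, xi)|^2 <= 3 exp(- kappa t lambda(xi)) |W_0(xi)|^2 with
    lambda(xi) = |xi|^2 / (|xi|^(2 rho) + |xi|^(2 theta)). For |xi| >= 1 the
    rate lambda is bounded below and the H^s norm controls an exponentially
    decaying remainder. For |xi| <= 1, lambda >= |xi|^(2 - 2 rho) / 2, and the
    Fourier integral satisfies |W_0(xi)| <= |int U_0| + C |xi|^gamma times the
    weighted L^1 norm; scaling xi by (1 + t)^(1 / (2 - 2 rho)) gives the rates.
    As W_0 is only an L^2 limit, the last bound is proved for the truncated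
    Fourier integrals, uniformly up to an error that vanishes in the limit of
    the integrated estimate. *)
Require Import Defs.
From HB Require Import structures.
From mathcomp Require Import all_boot all_order all_algebra.
From mathcomp Require Import complex ring lra.
From mathcomp Require Import all_classical all_reals all_analysis measurable_realfun.

Set Implicit Arguments.
Unset Strict Implicit.
Unset Printing Implicit Defensive.

Import Order.TTheory GRing.Theory Num.Theory.
Import numFieldNormedType.Exports.
Local Open Scope classical_set_scope.
Local Open Scope ring_scope.

(** * Exponential decay of one pair of components at a fixed frequency *)

Lemma gronwall_right_halfline (R : realType) (k : R) (f df : R -> R) :
  (forall t : R, 0 < t -> is_derive t (1 : R) f (df t)) ->
  (forall t : R, 0 < t -> df t <= - k * f t) ->
  f t @[t --> (0 : R)^'+] --> f 0 ->
  forall t : R, 0 <= t -> f t <= expR (- (k * t)) * f 0.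
Proof.
move=> fd fle f0 t t0.
(* With this integrating factor the hypothesis says that [g] has a nonpositive derivative for
   [t > 0]; continuity from the right at [0] makes [g] nonincreasing on the closed half-line. *)
pose g (t : R) := expR (k * t) * f t.
have gd (x : R) : 0 < x -> is_derive x (1 : R) g (expR (k * x) * (df x + k * f x)).
  move=> x0; have fx := fd x x0.
  have hk : is_derive x (1 : R) ((k *: (@id R)) : R -> R) k.
    by apply: is_derive_eq; rewrite /GRing.scale/= mulr1.
  have hE : is_derive x (1 : R) (expR \o (k *: (@id R)) : R -> R) (expR (k * x) * k).
    exact: is_derive1_comp.
  have -> : g = (expR \o (k *: (@id R)) : R -> R) * f by [].
  apply: is_derive_eq.
  by rewrite /GRing.scale/=; ring.
have gle : g t <= g 0.
  apply: (@ler0_derive1_nincry _ g 0) => //.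
  - by move=> x; rewrite in_itv/= andbT => /gd[].
  - move=> x; rewrite in_itv/= andbT => x0.
    have gx := gd x x0; rewrite derive1E derive_val.
    by rewrite pmulr_rle0 ?expR_gt0//; move: (fle x x0); lra.
  apply/continuous_within_itvcyP; split.
    move=> x; rewrite in_itv/= andbT => /gd[+ _].
    by move=> /derivable1_diffP/differentiable_continuous.
  apply: cvgM => //.
  apply: cvg_at_right_filter.
  apply: continuous_comp; last exact: continuous_expR.
  by apply: cvgMr; exact: cvg_id.
rewrite -(ler_pM2l (expR_gt0 (k * t))) mulrA -expRD subrr expR0 mul1r.
by move: gle; rewrite /g mulr0 expR0 mul1r.
Qed.

Section LyapunovPair.
Variables (R : realType) (h r c c0 d : R).
Hypotheses (r_ge0 : 0 <= r) (rh : r <= h) (c0_gt0 : 0 < c0) (c0c : c0 <= c).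
Hypotheses (d_gt0 : 0 < d) (d_le1 : d <= 1) (dc : d <= c) (dc2 : d * c <= 2^-1).

Let h_ge0 : 0 <= h. Proof. exact: le_trans rh. Qed.

(* The quadratic form is dissipative in [p = u + v] only; the cross term
   [u1 v2 - u2 v1] with weight [d r / h] recovers the direction [q = u - v]. *)
Lemma lyapunov_ineq (a1 a2 b1 b2 : R) :
  - (h * ((a1 + b1) ^+ 2 + (a2 + b2) ^+ 2))
  + d * r / h * (h * (a1 * b2 - a2 * b1)
     - r * c / 2 * ((a1 - b1) ^+ 2 + (a2 - b2) ^+ 2
                    - ((a1 + b1) ^+ 2 + (a2 + b2) ^+ 2)))
  <= - (d * c0 / 4 * (r ^+ 2 / h))
     * (a1 ^+ 2 + a2 ^+ 2 + b1 ^+ 2 + b2 ^+ 2 - d * r / h * (a1 * b2 - a2 * b1)).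
Proof.
move: h_ge0; rewrite le_eqVlt => /predU1P[h0|h0].
  (* Division by zero gives zero, so both sides vanish when [h = 0]. *)
  by rewrite -h0 !(invr0, mulr0, mul0r) ?oppr0 !(addr0, mul0r).
pose e := r / h.
have e0 : 0 <= e by rewrite divr_ge0 // ltW.
have e1 : e <= 1 by rewrite ler_pdivrMr // mul1r.
have rE : r = e * h by rewrite divfK // gt_eqF.
have -> : d * r / h = d * e by rewrite mulrA.
have -> : r ^+ 2 / h = e ^+ 2 * h.
  by rewrite rE; field; rewrite gt_eqF.
rewrite rE.
set p1 := a1 + b1; set p2 := a2 + b2; set q1 := a1 - b1; set q2 := a2 - b2.
have -> : a1 * b2 - a2 * b1 = (p2 * q1 - p1 * q2) / 2.
  by rewrite /p1 /p2 /q1 /q2; field.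
have -> : a1 ^+ 2 + a2 ^+ 2 + b1 ^+ 2 + b2 ^+ 2
    = (p1 ^+ 2 + p2 ^+ 2 + q1 ^+ 2 + q2 ^+ 2) / 2.
  by rewrite /p1 /p2 /q1 /q2; field.
move: p1 p2 q1 q2 => p1 p2 q1 q2.
(* [P] is the part that is damped directly, [Q] the part to be recovered, and [J] is twice the cross
   term. *)
pose P := p1 ^+ 2 + p2 ^+ 2; pose Q := q1 ^+ 2 + q2 ^+ 2; pose J := p2 * q1 - p1 * q2.
have P0 : 0 <= P by rewrite addr_ge0 ?sqr_ge0.
have Q0 : 0 <= Q by rewrite addr_ge0 ?sqr_ge0.
have c_gt0 : 0 < c by apply: lt_le_trans c0c.
(* Young's inequality, weighted so that [Q] carries the factor [e ^+ 2] of the recovered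
   dissipation. *)
have J1 : e * c * J <= ((e * c) ^+ 2 * Q + P) / 2.
  have : 0 <= (e * c * q1 - p2) ^+ 2 + (e * c * q2 + p1) ^+ 2.
    by rewrite addr_ge0 ?sqr_ge0.
  rewrite /P /Q /J; nra.
have J2 : - J <= (P + Q) / 2.
  have : 0 <= (q1 + p2) ^+ 2 + (q2 - p1) ^+ 2 by rewrite addr_ge0 ?sqr_ge0.
  rewrite /P /Q /J; nra.
have dec : d * e <= 1 by rewrite mulr_ile1 // ltW.
(* The damping of the cross term costs half of the dissipation [d * e ^+ 2 * c / 2 * Q] and, because
   [d <= c], a quarter of [P]. *)
have step1 : d * e * J / 2 <= d * e ^+ 2 * c / 4 * Q + P / 4.
  have dJ : d * e * J <= d / c * (((e * c) ^+ 2 * Q + P) / 2).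
    have -> : d * e * J = d / c * (e * c * J) by field; rewrite gt_eqF.
    by rewrite ler_wpM2l // divr_ge0 // ltW.
  have dcP : d / c * P <= P.
    by rewrite ler_piMl // ler_pdivrMr // mul1r.
  have E : d / c * (((e * c) ^+ 2 * Q + P) / 2)
      = d * e ^+ 2 * c / 2 * Q + d / c * P / 2.
    by field; rewrite gt_eqF.
  lra.
have step2 : (p1 ^+ 2 + p2 ^+ 2 + q1 ^+ 2 + q2 ^+ 2) / 2 - d * e * (J / 2) <= P + Q.
  have : - (d * e * (J / 2)) <= (P + Q) / 4.
    have [Jge|Jlt] := leP 0 J.
      have : 0 <= d * e * (J / 2) by rewrite !mulr_ge0 // ?invr_ge0 // ltW.
      lra.
    have : d * e * (- J / 2) <= - J / 2 by rewrite ler_piMl //; lra.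
    lra.
  have -> : p1 ^+ 2 + p2 ^+ 2 + q1 ^+ 2 + q2 ^+ 2 = P + Q by rewrite /P /Q !addrA.
  clearbody P Q J; lra.
have E : - (h * P) + d * e * (h * (J / 2) - e * h * c / 2 * (Q - P))
   = h * (- P + d * e * J / 2 - d * e ^+ 2 * c / 2 * (Q - P)) by field.
have -> : q1 ^+ 2 + q2 ^+ 2 - (p1 ^+ 2 + p2 ^+ 2) = Q - P by [].
rewrite -/P -/J E.
set L := _ - d * e * (J / 2).
have -> : - (d * c0 / 4 * (e ^+ 2 * h)) * L = h * (- (d * e ^+ 2 * c0 / 4 * L)) by field.
rewrite ler_pM2l //.
have L1 : d * e ^+ 2 * c0 / 4 * L <= d * e ^+ 2 * c / 4 * (P + Q).
  apply: (@le_trans _ _ (d * e ^+ 2 * c0 / 4 * (P + Q))).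
    by rewrite ler_wpM2l // !mulr_ge0 ?sqr_ge0 ?invr_ge0 // ltW.
  apply: ler_wpM2r; first by rewrite addr_ge0.
  apply: ler_wpM2r; first by rewrite invr_ge0.
  by apply: ler_wpM2l => //; rewrite mulr_ge0 ?sqr_ge0 // ltW.
(* The cross term also creates a [P] term of the wrong sign; [d * c <= 2^-1] keeps it below [P / 4].
   Divided by [h], the left side is then at most [- P / 2 - d * e ^+ 2 * c / 4 * Q], and by [L1] the
   right side is at least [- d * e ^+ 2 * c / 4 * (P + Q)]. *)
have de : d * e ^+ 2 * c * P <= P / 2.
  have -> : P / 2 = 2^-1 * P by rewrite mulrC.
  rewrite ler_wpM2r // mulrAC; apply: le_trans dc2.
  by rewrite ler_piMr ?mulr_ge0 ?exprn_ile1 // ltW.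
have X0 : 0 <= d * e ^+ 2 * c * P.
  apply: mulr_ge0 => //; apply: mulr_ge0; last exact: ltW.
  by apply: mulr_ge0; [exact: ltW | exact: sqr_ge0].
clearbody P Q J L; move: step1 L1 de X0; clear => step1 L1 de X0; lra.
Qed.

(** The functional [L] decays by [lyapunov_ineq] and Gronwall. Its cross term is at most [E / 2] in
    absolute value and has weight at most 1, so [L] lies between [E / 2] and [3 / 2 * E]; the ratio
    of these bounds is the factor 3. The rate uses [c0] instead of the speed [c], so that two pairs
    with different speeds can share it. *)
Lemma pair_decay (u1 u2 v1 v2 : R -> R) :
  (forall t : R, 0 < t ->
     is_derive t (1 : R) u1 (- (h / 2 * (u1 t + v1 t)) - r * c * u2 t)) ->
  (forall t : R, 0 < t ->
     is_derive t (1 : R) u2 (- (h / 2 * (u2 t + v2 t)) + r * c * u1 t)) ->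
  (forall t : R, 0 < t ->
     is_derive t (1 : R) v1 (- (h / 2 * (u1 t + v1 t)) + r * c * v2 t)) ->
  (forall t : R, 0 < t ->
     is_derive t (1 : R) v2 (- (h / 2 * (u2 t + v2 t)) - r * c * v1 t)) ->
  u1 t @[t --> (0 : R)^'+] --> u1 0 -> u2 t @[t --> (0 : R)^'+] --> u2 0 ->
  v1 t @[t --> (0 : R)^'+] --> v1 0 -> v2 t @[t --> (0 : R)^'+] --> v2 0 ->
  forall t : R, 0 <= t ->
    u1 t ^+ 2 + u2 t ^+ 2 + v1 t ^+ 2 + v2 t ^+ 2 <=
    3 * expR (- (d * c0 / 4 * (r ^+ 2 / h) * t))
      * (u1 0 ^+ 2 + u2 0 ^+ 2 + v1 0 ^+ 2 + v2 0 ^+ 2).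
Proof.
move=> du1 du2 dv1 dv2 cu1 cu2 cv1 cv2 t t0.
set k := d * c0 / 4 * (r ^+ 2 / h).
pose de := d * r / h.
pose E (t : R) := u1 t ^+ 2 + u2 t ^+ 2 + v1 t ^+ 2 + v2 t ^+ 2.
pose L (t : R) := E t - de * (u1 t * v2 t - u2 t * v1 t).
have de0 : 0 <= de by rewrite divr_ge0 // mulr_ge0 // ltW.
have de1 : de <= 1.
  rewrite /de; move: h_ge0; rewrite le_eqVlt => /predU1P[<-|h0].
    by rewrite invr0 mulr0.
  by rewrite ler_pdivrMr // mul1r; apply: le_trans rh; rewrite ler_piMl.
have bnd (x : R) : E x / 2 <= L x /\ L x <= 3 / 2 * E x.
  have H1 : 0 <= E x / 2 - (u1 x * v2 x - u2 x * v1 x).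
    have : 0 <= (u1 x - v2 x) ^+ 2 + (u2 x + v1 x) ^+ 2 by rewrite addr_ge0 ?sqr_ge0.
    by rewrite /E; nra.
  have H2 : 0 <= E x / 2 + (u1 x * v2 x - u2 x * v1 x).
    have : 0 <= (u1 x + v2 x) ^+ 2 + (u2 x - v1 x) ^+ 2 by rewrite addr_ge0 ?sqr_ge0.
    by rewrite /E; nra.
  rewrite /L; move: (u1 x * v2 x - _) H1 H2 => J H1 H2.
  by split; nra.
have Ldec : L t <= expR (- (k * t)) * L 0.
  apply: (@gronwall_right_halfline R k L (fun x =>
      - (h * ((u1 x + v1 x) ^+ 2 + (u2 x + v2 x) ^+ 2))
      + d * r / h * (h * (u1 x * v2 x - u2 x * v1 x)
     - r * c / 2 * ((u1 x - v1 x) ^+ 2 + (u2 x - v2 x) ^+ 2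
                    - ((u1 x + v1 x) ^+ 2 + (u2 x + v2 x) ^+ 2))))) => //.
  - move=> x x0.
    have := du1 x x0; have := du2 x x0; have := dv1 x x0; have := dv2 x x0 => ? ? ? ?.
    have -> : L = (u1 ^+ 2 + u2 ^+ 2 + v1 ^+ 2 + v2 ^+ 2)
        - de *: (u1 * v2 - u2 * v1) :> (R -> R).
      by apply/funext => y; rewrite /L /E.
    apply: is_derive_eq.
    by rewrite /GRing.scale/= -/de; field.
  - by move=> x x0; exact: lyapunov_ineq.
  - rewrite /L /E; apply: cvgB; last first.
      by apply: cvgMr; apply: cvgB; apply: cvgM.
    by repeat (apply: cvgD => //); rewrite !expr2; apply: cvgM.
have [B1 _] := bnd t; have [_ B2] := bnd 0.
have : expR (- (k * t)) * L 0 <= expR (- (k * t)) * (3 / 2 * E 0).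
  by rewrite ler_pM2l // expR_gt0.
rewrite -!/(E _); lra.
Qed.
End LyapunovPair.

(** * The transformed system: splitting into two pairs and pointwise decay *)

Section FourierODE.
Variable R : realType.
Implicit Types (a b rho theta r t : R) (xi : plane R).

Lemma big_ord4 (V : nmodType) (F : 'I_4 -> V) : \sum_(k < 4) F k = F 0 + F 1 + F 2 + F 3.
Proof.
rewrite !big_ord_recl big_ord0 addr0 !addrA.
by congr (_ + _ + _ + _); congr F; apply/val_inj.
Qed.

Lemma cnorm4_sq (v : C4 R) :
  cnorm4 v ^+ 2 = \sum_(k < 4) (complex.Re (v k ord0) ^+ 2 + complex.Im (v k ord0) ^+ 2).
Proof. by rewrite sqr_sqrtr // sumr_ge0 // => k _; rewrite addr_ge0 ?sqr_ge0. Qed.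

Lemma enorm_ge0 xi : 0 <= enorm xi.
Proof. exact: sqrtr_ge0. Qed.

Lemma cnorm4_ge0 (v : C4 R) : 0 <= cnorm4 v.
Proof. exact: sqrtr_ge0. Qed.

(** The eigenvalue of the damping matrix on the sums [W_1 + W_3] and [W_2 + W_4]: there [B0] has
    eigenvalue 2, which cancels the factor one half of the symbol. *)
Definition damping rho theta r := r `^ (2 * rho) + r `^ (2 * theta).

(** Row [i] involves only the component [i] and its partner [j], two places away. Here [c] is minus
    the [i]-th diagonal entry of [B1], so the equation of the partner is the same one with [- c]. *)
Lemma symbol_mul a b rho theta xi (y : C4 R) (i j : 'I_4) (c : R) :
  [|| [&& i == 0, j == 2 & c == b], [&& i == 1, j == 3 & c == a],
      [&& i == 2, j == 0 & c == - b] | [&& i == 3, j == 1 & c == - a]] ->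
  let h := damping rho theta (enorm xi) in
  let r := enorm xi in
  complex.Re ((- (symbol a b rho theta xi *m y)) i ord0)
    = - (h / 2 * (complex.Re (y i ord0) + complex.Re (y j ord0)))
      - r * c * complex.Im (y i ord0) /\
  complex.Im ((- (symbol a b rho theta xi *m y)) i ord0)
    = - (h / 2 * (complex.Im (y i ord0) + complex.Im (y j ord0)))
      + r * c * complex.Re (y i ord0).
Proof.
move=> H h r; rewrite /symbol -/r.
have -> : r `^ (2 * rho) + r `^ (2 * theta) = h by [].
move: h r => h r {xi}.
by case/or4P: H => /and3P[/eqP -> /eqP -> /eqP ->]; rewrite !mxE;
  rewrite big_ord4 !mxE /=;
  move: (y 0 ord0) (y 1 ord0) (y 2 ord0) (y 3 ord0)
    => [y0 z0] [y1 z1] [y2 z2] [y3 z3];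
  rewrite !(mulr0n, mulr1n, mulr0, mulr1, addr0, add0r, mul0r) /=; split; field.
Qed.

Lemma damping_ge0 rho theta r : 0 <= damping rho theta r.
Proof. by rewrite addr_ge0 // powR_ge0. Qed.

(** For [r >= 1] the power with exponent [2 * theta > 1] dominates [r], for [r <= 1] the one with
    exponent [2 * rho < 1]. This keeps the weight of the cross term bounded. *)
Lemma le_damping rho theta r : 0 <= rho -> rho < 2^-1 -> 2^-1 < theta ->
  0 <= r -> r <= damping rho theta r.
Proof.
move=> rho0 rho1 th1; rewrite le_eqVlt => /predU1P[<-|r0]; first exact: damping_ge0.
have [r1|/ltW r1] := leP 1 r.
- rewrite ler_wpDl ?powR_ge0 // -{1}(powRr1 (ltW r0)) ler_powR //; lra.
- rewrite ler_wpDr ?powR_ge0 // -{1}(powRr1 (ltW r0)) ger_powR ?r0 ?r1 //; lra.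
Qed.

Lemma ode_decay a b rho theta : 0 < a -> a < b ->
  0 <= rho -> rho < 2^-1 -> 2^-1 < theta ->
  exists2 kappa : R, 0 < kappa &
    forall xi (y : R -> C4 R), solves_ode (symbol a b rho theta xi) y ->
    forall t, 0 <= t ->
      cnorm4 (y t) ^+ 2 <=
      3 * expR (- (kappa * (enorm xi ^+ 2 / damping rho theta (enorm xi)) * t))
        * cnorm4 (y 0) ^+ 2.
Proof.
move=> a0 ab rho0 rho1 th1.
have b0 : 0 < b by apply: lt_trans ab.
(* The largest [d] meeting the conditions of [pair_decay] for both speeds: [d <= 1], [d <= a < b]
   and [d * a <= d * b <= 2^-1]. The common lower bound of the speeds is [a]. *)
pose d := Num.min (Num.min 1 a) (2 * b)^-1.
have d0 : 0 < d by rewrite !lt_min ltr01 a0 invr_gt0 mulr_gt0.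
have d1 : d <= 1 by rewrite !ge_min lexx.
have da : d <= a by rewrite !ge_min lexx orbT.
have db2 : d * b <= 2^-1.
  rewrite -ler_pdivlMr // -invfM // ge_min; apply/orP; right; by rewrite lexx.
exists (d * a / 4); first by rewrite divr_gt0 ?mulr_gt0.
move=> xi y [dy cy] t t0.
have r0 := enorm_ge0 xi.
have rh := le_damping rho0 rho1 th1 r0.
have pair (i j : 'I_4) (c : R) :
    (i == 0) && (j == 2) && (c == b) || (i == 1) && (j == 3) && (c == a) ->
    complex.Re (y t i ord0) ^+ 2 + complex.Im (y t i ord0) ^+ 2
      + complex.Re (y t j ord0) ^+ 2 + complex.Im (y t j ord0) ^+ 2 <=
    3 * expR (- (d * a / 4 * (enorm xi ^+ 2 / damping rho theta (enorm xi)) * t))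
      * (complex.Re (y 0 i ord0) ^+ 2 + complex.Im (y 0 i ord0) ^+ 2
         + complex.Re (y 0 j ord0) ^+ 2 + complex.Im (y 0 j ord0) ^+ 2).
  move=> Hij.
  have Ei v := @symbol_mul a b rho theta xi v i j c.
  have Ej v := @symbol_mul a b rho theta xi v j i (- c).
  have {}Ei v := Ei v ltac:(by case/orP: Hij => /andP[/andP[-> ->] ->]; rewrite ?orbT).
  have {}Ej v := Ej v ltac:(by case/orP: Hij => /andP[/andP[-> ->] /eqP->]; rewrite !eqxx ?orbT).
  apply: (@pair_decay R (damping rho theta (enorm xi)) (enorm xi) c a d r0 rh a0 _ d0 d1 _ _
     (fun t => complex.Re (y t i ord0)) (fun t => complex.Im (y t i ord0))
     (fun t => complex.Re (y t j ord0)) (fun t => complex.Im (y t j ord0))) => //.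
  - by case/orP: Hij => /andP[_ /eqP->] //; exact: ltW.
  - by case/orP: Hij => /andP[_ /eqP->] //; apply: (le_trans da); exact: ltW.
  - case/orP: Hij => /andP[_ /eqP->] //; apply: le_trans db2.
    by rewrite ler_wpM2l // ltW.
  - by move=> x x0; have [h1 _] := dy x i x0; move: h1; rewrite (Ei _).1.
  - by move=> x x0; have [_ h1] := dy x i x0; move: h1; rewrite (Ei _).2.
  - move=> x x0; have [h1 _] := dy x j x0; move: h1; rewrite (Ej _).1.
    by move=> h1; apply: is_derive_eq; ring.
  - move=> x x0; have [_ h1] := dy x j x0; move: h1; rewrite (Ej _).2.
    by move=> h1; apply: is_derive_eq; ring.
  - by have [] := cy i.
  - by have [] := cy i.
  - by have [] := cy j.
  - by have [] := cy j.
have P1 := pair 0 2 b ltac:(by rewrite !eqxx).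
have P2 := pair 1 3 a ltac:(by rewrite !eqxx orbT).
rewrite !cnorm4_sq !big_ord4; lra.
Qed.
End FourierODE.

(** * Elementary bounds on the decay rate and on exponentials *)

Section FrequencyRates.
Variable R : realType.
Implicit Types (rho theta r t sigma c k m p z : R) (xi : plane R).

(** On [[0, 1]] the power with the smaller exponent dominates, so the damping is at most twice [r]
    to the power [2 * rho]. *)
Lemma rate_low rho theta r : 0 <= rho -> rho < 2^-1 -> 2^-1 < theta ->
  0 <= r <= 1 -> r `^ (2 - 2 * rho) / 2 <= r ^+ 2 / damping rho theta r.
Proof.
move=> rho0 rho1 th1 /andP[]; rewrite le_eqVlt => /predU1P[<-|r0] r1.
  rewrite expr0n mul0r powR0 ?mul0r //; apply/negP => /eqP; lra.
have h0 : 0 < damping rho theta r by rewrite addr_gt0 // powR_gt0.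
rewrite ler_pdivlMr // powRB ?(gt_eqF r0) ?implybT //.
have -> : r `^ 2 = r ^+ 2 by rewrite powR_mulrn // ltW.
have p0 : 0 < r `^ (2 * rho) by rewrite powR_gt0.
have le2 : r `^ (2 * theta) <= r `^ (2 * rho).
  by rewrite ger_powR ?r0 ?r1 //; lra.
rewrite -(ler_pM2r p0).
have -> : r ^+ 2 / r `^ (2 * rho) / 2 * damping rho theta r * r `^ (2 * rho)
   = r ^+ 2 / 2 * damping rho theta r by field; rewrite gt_eqF.
rewrite -mulrA ler_wpM2l ?sqr_ge0 // /damping; lra.
Qed.

(** Both exponents are at most 2, the second one because [theta <= 1], so the damping is at most
    [2 * r ^+ 2]. *)
Lemma rate_high rho theta r : 0 <= rho -> rho < 2^-1 -> 2^-1 < theta ->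
  theta <= 1 -> 1 <= r -> 2^-1 <= r ^+ 2 / damping rho theta r.
Proof.
move=> rho0 rho1 th1 th2 r1.
have r0 : 0 < r by apply: lt_le_trans r1.
have h0 : 0 < damping rho theta r by rewrite addr_gt0 // powR_gt0.
rewrite ler_pdivlMr //.
have r2 : r `^ 2 = r ^+ 2 by rewrite powR_mulrn // ltW.
have : r `^ (2 * rho) <= r `^ 2 by rewrite ler_powR //; lra.
have : r `^ (2 * theta) <= r `^ 2 by rewrite ler_powR //; lra.
rewrite r2 /damping; lra.
Qed.

(** From [y <= expR y] at [y = c * z / sigma], raised to the power [sigma]. *)
Lemma powR_le_expR sigma c : 0 <= sigma -> 0 < c ->
  exists2 K : R, 0 < K & forall z, 0 <= z -> z `^ sigma <= K * expR (c * z).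
Proof.
rewrite le_eqVlt => /predU1P[<-|s0] c0.
  exists 1 => // z z0; rewrite powRr0 mul1r.
  by rewrite -expR0 ler_expR mulr_ge0 // ltW.
exists ((sigma / c) `^ sigma); first by rewrite powR_gt0 // divr_gt0.
move=> z z0.
have zle : z <= sigma / c * expR (c * z / sigma).
  have := expR_ge1Dx (c * z / sigma) => H.
  apply: (@le_trans _ _ (sigma / c * (c * z / sigma))).
    by rewrite le_eqVlt; apply/orP; left; apply/eqP; field; rewrite !gt_eqF.
  by rewrite ler_wpM2l ?divr_ge0 ?ltW //; lra.
have := ge0_ler_powR (ltW s0) z0 _ zle => /(_ _)/le_trans -> //.
  by rewrite nnegrE mulr_ge0 ?expR_ge0 // divr_ge0 // ltW.
rewrite powRM ?expR_ge0 ?divr_ge0 ?(ltW s0) ?(ltW c0) // -expRM.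
by rewrite divfK // gt_eqF.
Qed.

Lemma norm1_le_enorm xi : `|xi.1| <= enorm xi.
Proof. by rewrite -sqrtr_sqr ler_wsqrtr // lerDl sqr_ge0. Qed.

Lemma norm2_le_enorm xi : `|xi.2| <= enorm xi.
Proof. by rewrite -sqrtr_sqr ler_wsqrtr // lerDr sqr_ge0. Qed.

(* Scaling: with [z = (1 + t) ^ (1 / m) r] the exponent [r ^ m t] is at least
   [z ^ m - 1 >= z - 2], and half of the decay in [z] absorbs [z ^ (2 sigma)]. *)
Lemma diffusion_le_exp sigma k m : 0 <= sigma -> 0 < k -> 1 < m ->
  exists2 K : R, 0 < K & forall t xi, 0 <= t -> enorm xi <= 1 ->
  enorm xi `^ (2 * sigma) * expR (- (k * enorm xi `^ m * t)) <=
  K * ((1 + t) `^ m^-1) `^ (- (2 * sigma)) *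
    (expR (- (k / 4 * (1 + t) `^ m^-1) * `|xi.1|)
     * expR (- (k / 4 * (1 + t) `^ m^-1) * `|xi.2|)).
Proof.
move=> s0 k0 m1.
have [||K1 K10 HK1] := @powR_le_expR (2 * sigma) (k / 2).
- by rewrite mulr_ge0.
- by rewrite divr_gt0.
exists (K1 * expR (2 * k)); first by rewrite mulr_gt0 ?expR_gt0.
move=> t xi t0; set tau := (1 + t) `^ m^-1; set r := enorm xi => r1.
have m0 : 0 < m by apply: lt_trans m1.
have t1 : 0 < 1 + t by rewrite ltr_pwDl.
have tau0 : 0 < tau by rewrite powR_gt0.
have r0 : 0 <= r := enorm_ge0 xi.
pose z := tau * r.
have z0 : 0 <= z by rewrite mulr_ge0 // ltW.
have zm : z `^ m = (1 + t) * r `^ m.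
  rewrite powRM ?(ltW tau0) // /tau -powRrM mulVf ?(gt_eqF m0) //.
  by rewrite (powRr1 (ltW t1)).
have zle : z - 1 <= z `^ m.
  have [z1|z1] := leP 1 z; last first.
    by apply: le_trans (powR_ge0 _ _); lra.
  apply: (@le_trans _ _ z); first lra.
  by rewrite -{1}(powRr1 z0) ler_powR // ltW.
have rm1 : r `^ m <= 1.
  have := ge0_ler_powR (ltW m0) r0 ler01 r1; rewrite powR1; exact.
have e1 : expR (- (k * r `^ m * t)) <= expR (2 * k) * expR (- (k * z)).
  rewrite -expRD ler_expR.
  have : k * (z - 2) <= k * (r `^ m * t) by rewrite ler_pM2l //; lra.
  lra.
have rE : r `^ (2 * sigma) = tau `^ (- (2 * sigma)) * z `^ (2 * sigma).
  rewrite powRM ?(ltW tau0) // mulrA -powRD ?(gt_eqF tau0) ?implybT //.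
  by rewrite addNr powRr0 mul1r.
have T0 := powR_ge0 tau (- (2 * sigma)).
have e2 : z `^ (2 * sigma) * expR (- (k * z)) <= K1 * expR (- (k / 2 * z)).
  apply: (@le_trans _ _ (K1 * expR (k / 2 * z) * expR (- (k * z)))).
    by rewrite ler_wpM2r ?expR_ge0 // HK1.
  rewrite -mulrA -expRD.
  by rewrite le_eqVlt; apply/orP; left; apply/eqP; congr (_ * expR _); field.
(* Since [|xi_1| + |xi_2| <= 2 r], the radial decay yields a product of one-variable exponentials,
   whose integral is explicit. *)
have e3 : expR (- (k / 2 * z)) <=
    expR (- (k / 4 * tau) * `|xi.1|) * expR (- (k / 4 * tau) * `|xi.2|).
  rewrite -expRD ler_expR.
  have : k / 4 * tau * (`|xi.1| + `|xi.2|) <= k / 4 * tau * (r + r).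
    apply: ler_wpM2l; first by rewrite !mulr_ge0 ?invr_ge0 ?(ltW k0) ?(ltW tau0).
    by rewrite lerD ?norm1_le_enorm ?norm2_le_enorm.
  rewrite /z; lra.
rewrite rE.
apply: (@le_trans _ _ (tau `^ (- (2 * sigma)) * z `^ (2 * sigma)
          * (expR (2 * k) * expR (- (k * z))))).
  by rewrite ler_wpM2l // mulr_ge0 // powR_ge0.
have -> : tau `^ (- (2 * sigma)) * z `^ (2 * sigma) * (expR (2 * k) * expR (- (k * z)))
  = expR (2 * k) * tau `^ (- (2 * sigma)) * (z `^ (2 * sigma) * expR (- (k * z))) by ring.
apply: (@le_trans _ _ (expR (2 * k) * tau `^ (- (2 * sigma)) * (K1 * expR (- (k / 2 * z))))).
  by rewrite ler_wpM2l // mulr_ge0 // expR_ge0.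
have -> : expR (2 * k) * tau `^ (- (2 * sigma)) * (K1 * expR (- (k / 2 * z)))
  = K1 * expR (2 * k) * tau `^ (- (2 * sigma)) * expR (- (k / 2 * z)) by ring.
by rewrite ler_wpM2l // !mulr_ge0 ?expR_ge0 // ltW.
Qed.

Lemma expR_le_powR k p : 0 < k -> 0 <= p ->
  exists2 K : R, 0 < K & forall t, 0 <= t -> expR (- (k * t)) <= K * (1 + t) `^ (- p).
Proof.
move=> k0 p0; have [K K0 HK] := powR_le_expR p0 k0.
exists (K * expR k); first by rewrite mulr_gt0 ?expR_gt0.
move=> t t0.
have t1 : 0 < 1 + t by rewrite ltr_pwDl.
have := HK _ (ltW t1); rewrite powRN ler_pdivlMr ?powR_gt0 // => H.
apply: (@le_trans _ _ (expR (- (k * t)) * (K * expR (k * (1 + t))))).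
  by rewrite ler_pM2l ?expR_gt0.
rewrite mulrCA -expRD le_eqVlt; apply/orP; left; apply/eqP.
by congr (_ * expR _); ring.
Qed.
End FrequencyRates.

(** * Lebesgue measure on the plane and measurability of the Fourier integrals *)

Lemma sigma_finite_leb2 (R : realType) : sigma_finite setT (leb2 R).
Proof.
have /sigma_finiteP[F [TF ndF Foo]] := sigma_finiteT (@lebesgue_measure R).
exists (fun n => F n `*` F n).
  rewrite -setXTT TF; apply/seteqP; split => [[x y] /= [[n _ Fnx] [k _ Fky]]|].
    exists (maxn n k) => //; split.
    - by move: x Fnx; exact/subsetPset/ndF/leq_maxl.
    - by move: y Fky; exact/subsetPset/ndF/leq_maxr.
  by move=> [x y] [n _ []/= ? ?]; split; exists n.
move=> k; have [mF Fk] := Foo k; split; first exact: measurableX.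
by rewrite product_measure1E // lte_mul_pinfty // ge0_fin_numE.
Qed.

(* An alias: on products of measures the sigma-finite structure that the
   library infers is the one of products of probabilities. *)
Definition leb2_sf (R : realType) : set (plane R) -> \bar R := leb2 R.
HB.instance Definition _ (R : realType) := Measure.copy (@leb2_sf R) (leb2 R).
HB.instance Definition _ (R : realType) :=
  Measure_isSigmaFinite.Build _ _ _ (@leb2_sf R) (@sigma_finite_leb2 R).

Section PlaneMeasurability.
Variable R : realType.
Implicit Types (f g : plane R -> C4 R) (xi : plane R).

Lemma measurable_enorm : measurable_fun setT (@enorm R).
Proof.
apply: measurableT_comp; first exact: continuous_measurable_fun (@sqrt_continuous R).
by apply: measurable_funD; apply: measurable_funX.
Qed.

Lemma measurable_cnorm4 f : measurable_C4 f -> measurable_fun setT (fun x => cnorm4 (f x)).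
Proof.
move=> mf; apply: measurableT_comp; first exact: continuous_measurable_fun (@sqrt_continuous R).
apply: measurable_sum => k; have [? ?] := mf k.
by apply: measurable_funD; apply: measurable_funX.
Qed.

(** The positive and the negative part of the integrand, extended by zero off [D], have measurable
    partial integrals by Tonelli; the real integral is the finite part of their difference. *)
Lemma measurable_Rintegral_param (D : set (plane R)) (F : plane R -> plane R -> R) :
  measurable D -> measurable_fun setT (fun z : plane R * plane R => F z.1 z.2) ->
  measurable_fun setT (fun xi => \int[leb2 R]_(x in D) F x xi).
Proof.
move=> mD mF.
under eq_fun do rewrite Rintegral_mkcond.
apply: measurableT_comp; first exact: fine_measurable.
have mG : measurable_fun setT
    (fun z : plane R * plane R => (((F ^~ z.2) \_ D) z.1)%:E).
  apply/measurable_EFinP.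
  have -> : (fun z : plane R * plane R => ((F ^~ z.2) \_ D) z.1)
     = (fun z => \1_D z.1 * F z.1 z.2).
    apply/funext => z; rewrite /patch indicE.
    by case: ifP => _; rewrite ?mul1r ?mul0r.
  apply: measurable_funM => //.
  exact: measurableT_comp (measurable_indic mD) _.
under eq_fun do rewrite integralE.
apply: emeasurable_funB.
- apply: (@measurable_fun_fubini_tonelli_G _ _ _ _ _ (@leb2_sf R)
    (fun z => ((EFin \o (F ^~ z.2 \_ D))^\+ z.1)%E)) => //.
  have -> : (fun z => ((EFin \o (F ^~ z.2 \_ D))^\+ z.1)%E)
    = ((fun z : plane R * plane R => (((F ^~ z.2) \_ D) z.1)%:E)^\+)%E.
    by apply/funext => z; rewrite !funeposE.
  exact: measurable_funepos.
- apply: (@measurable_fun_fubini_tonelli_G _ _ _ _ _ (@leb2_sf R)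
    (fun z => ((EFin \o (F ^~ z.2 \_ D))^\- z.1)%E)) => //.
  have -> : (fun z => ((EFin \o (F ^~ z.2 \_ D))^\- z.1)%E)
    = ((fun z : plane R * plane R => (((F ^~ z.2) \_ D) z.1)%:E)^\-)%E.
    by apply/funext => z; rewrite !funenegE.
  exact: measurable_funeneg.
Qed.

Lemma measurable_ball_enorm (n : nat) : measurable [set x : plane R | enorm x <= n%:R].
Proof.
rewrite -[X in measurable X]setTI.
by apply: measurable_fun_le => //; exact: measurable_enorm.
Qed.

Lemma measurable_trunc_fourier n f : measurable_C4 f -> measurable_C4 (trunc_fourier n f).
Proof.
move=> mf k; have [mRe mIm] := mf k.
have mdot : measurable_fun setT (fun z : plane R * plane R => dotp z.1 z.2).
  apply: measurable_funD; apply: measurable_funM.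
  - exact: (measurableT_comp measurable_fst measurable_fst).
  - exact: (measurableT_comp measurable_fst measurable_snd).
  - exact: (measurableT_comp measurable_snd measurable_fst).
  - exact: (measurableT_comp measurable_snd measurable_snd).
have mcos : measurable_fun setT (fun z : plane R * plane R => cos (dotp z.1 z.2)).
  exact: measurableT_comp (continuous_measurable_fun (@continuous_cos R)) mdot.
have msin : measurable_fun setT (fun z : plane R * plane R => sin (dotp z.1 z.2)).
  exact: measurableT_comp (continuous_measurable_fun (@continuous_sin R)) mdot.
have mRe' := measurableT_comp mRe (@measurable_fst _ _ (plane R) (plane R)).
have mIm' := measurableT_comp mIm (@measurable_fst _ _ (plane R) (plane R)).
split.
- under eq_fun do rewrite /trunc_fourier /integral_C4 mxE /=.
  apply: (@measurable_Rintegral_param _ (fun x xi => complex.Re ((expNi (dotp x xi) *: f x) k ord0))).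
    exact: measurable_ball_enorm.
  have -> : (fun z : plane R * plane R => complex.Re ((expNi (dotp z.1 z.2) *: f z.1) k ord0))
     = (fun z => cos (dotp z.1 z.2) * complex.Re (f z.1 k ord0)
          + sin (dotp z.1 z.2) * complex.Im (f z.1 k ord0)).
    apply/funext => z; rewrite mxE; case: (f z.1 k ord0) => p q /=.
    by rewrite mulNr opprK.
  by apply: measurable_funD; apply: measurable_funM.
- under eq_fun do rewrite /trunc_fourier /integral_C4 mxE /=.
  apply: (@measurable_Rintegral_param _ (fun x xi => complex.Im ((expNi (dotp x xi) *: f x) k ord0))).
    exact: measurable_ball_enorm.
  have -> : (fun z : plane R * plane R => complex.Im ((expNi (dotp z.1 z.2) *: f z.1) k ord0))
     = (fun z => cos (dotp z.1 z.2) * complex.Im (f z.1 k ord0)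
          - sin (dotp z.1 z.2) * complex.Re (f z.1 k ord0)).
    apply/funext => z; rewrite mxE; case: (f z.1 k ord0) => p q /=.
    by ring.
  by apply: measurable_funB; apply: measurable_funM.
Qed.
End PlaneMeasurability.

(** * Squared norms, and uniqueness of the Fourier transform up to null sets *)

Section L2Limits.
Variable R : realType.
Implicit Types (w : plane R -> R) (f g : plane R -> C4 R) (u v : C4 R).

Lemma wL2normE w f :
  wL2norm w f = ((\int[leb2 R]_x ((w x * cnorm4 (f x)) ^+ 2)%:E) `^ 2^-1)%E.
Proof.
rewrite /wL2norm unlock /=; congr (_ `^ _)%E.
apply: eq_integral => x _; rewrite powR_mulrn ?normr_ge0 //.
by rewrite real_normK // num_real.
Qed.

Lemma wL2int_ge0 w f : (0 <= \int[leb2 R]_x ((w x * cnorm4 (f x)) ^+ 2)%:E)%E.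
Proof. by apply: integral_ge0 => x _; rewrite lee_fin sqr_ge0. Qed.

(** Turns norm bounds into bounds on integrals of squares, which can be added pointwise. *)
Lemma wL2norm_le w f (c : R) : 0 <= c ->
  (wL2norm w f <= c%:E)%E = (\int[leb2 R]_x ((w x * cnorm4 (f x)) ^+ 2)%:E <= (c ^+ 2)%:E)%E.
Proof.
move=> c0; rewrite wL2normE; have := wL2int_ge0 w f.
case: (integral _ _ _) => [r| |] //.
  rewrite lee_fin => r0; rewrite poweR_EFin !lee_fin.
  rewrite (powR12_sqrt r0) -[in LHS](ger0_norm c0) -sqrtr_sqr.
  by rewrite ler_sqrt ?sqr_ge0.
by move=> _; rewrite poweRyr ?invr_eq0 ?pnatr_eq0.
Qed.

Lemma cnorm4N v : cnorm4 (- v) = cnorm4 v.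
Proof.
congr Num.sqrt; apply: eq_bigr => k _; rewrite mxE.
by case: (v k ord0) => p q /=; rewrite !sqrrN.
Qed.

Lemma cnorm4_eq0 v : cnorm4 v = 0 -> v = 0.
Proof.
move=> v0; have : cnorm4 v ^+ 2 = 0 by rewrite v0 expr0n.
rewrite cnorm4_sq => /eqP; rewrite psumr_eq0; last first.
  by move=> k _; rewrite addr_ge0 ?sqr_ge0.
move=> /allP H; apply/matrixP => k j; rewrite (ord1 j) mxE.
have := H k (mem_index_enum _) => /=.
rewrite paddr_eq0 ?sqr_ge0 // !sqrf_eq0.
by case: (v k ord0) => p q /= /andP[/eqP-> /eqP->].
Qed.

Lemma cnorm4D_sq u v : cnorm4 (u + v) ^+ 2 <= 2 * cnorm4 u ^+ 2 + 2 * cnorm4 v ^+ 2.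
Proof.
rewrite !cnorm4_sq !mulr_sumr -big_split /=; apply: ler_sum => k _.
rewrite mxE; case: (u k ord0) (v k ord0) => [p q] [p' q'] /=.
have := sqr_ge0 (p - p'); have := sqr_ge0 (q - q'); nra.
Qed.

Lemma measurable_C4B f g : measurable_C4 f -> measurable_C4 g ->
  measurable_C4 (fun x => f x - g x).
Proof.
move=> mf mg k; have [? ?] := mf k; have [? ?] := mg k; split.
- under eq_fun do rewrite !mxE raddfB /=; exact: measurable_funB.
- under eq_fun do rewrite !mxE raddfB /=; exact: measurable_funB.
Qed.

Lemma measurable_wL2 w f : measurable_fun setT w -> measurable_C4 f ->
  measurable_fun setT (fun x => ((w x * cnorm4 (f x)) ^+ 2)%:E).
Proof.
move=> mw mf; apply/measurable_EFinP; apply: measurable_funX.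
by apply: measurable_funM => //; exact: measurable_cnorm4.
Qed.

Lemma wL2int_split f g1 g2 :
  measurable_C4 f -> measurable_C4 g1 -> measurable_C4 g2 ->
  (\int[leb2 R]_x ((1 * cnorm4 (g1 x - g2 x)) ^+ 2)%:E <=
   2%:E * \int[leb2 R]_x ((1 * cnorm4 (f x - g1 x)) ^+ 2)%:E +
   2%:E * \int[leb2 R]_x ((1 * cnorm4 (f x - g2 x)) ^+ 2)%:E)%E.
Proof.
move=> mf mg1 mg2.
have m1 : measurable_fun setT (cst 1 : plane R -> R) by [].
have M1 := measurable_wL2 m1 (measurable_C4B mf mg1).
have M2 := measurable_wL2 m1 (measurable_C4B mf mg2).
have M3 := measurable_wL2 m1 (measurable_C4B mg1 mg2).
have pos u (x : plane R) : setT x -> (0 <= ((1 * cnorm4 u) ^+ 2)%:E :> \bar R)%E.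
  by rewrite lee_fin sqr_ge0.
rewrite -(ge0_integralZl _ measurableT M1 (fun x => pos _ x)) //.
rewrite -(ge0_integralZl _ measurableT M2 (fun x => pos _ x)) //.
rewrite -ge0_integralD //; try by move=> x _; rewrite mule_ge0 // lee_fin sqr_ge0.
- apply: ge0_le_integral => //.
  + by move=> x _; rewrite lee_fin sqr_ge0.
  + by apply: emeasurable_funD; apply: measurable_funeM.
  + move=> x _; rewrite -!EFinM -EFinD lee_fin !mul1r.
    have -> : g1 x - g2 x = - (f x - g1 x) + (f x - g2 x).
      by rewrite opprB addrA subrK.
    by rewrite (le_trans (cnorm4D_sq _ _)) // cnorm4N.
- exact: measurable_funeM.
- exact: measurable_funeM.
Qed.

Let two_halves_le (I I1 I2 : \bar R) (e : R) :
  (I <= 2%:E * I1 + 2%:E * I2 -> I1 <= e%:E -> I2 <= e%:E -> I <= (4 * e)%:E)%E.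
Proof.
move=> H H1 H2; apply: (le_trans H).
have -> : ((4 * e)%:E = 2%:E * e%:E + 2%:E * e%:E)%E.
  by rewrite -!EFinM -EFinD; congr EFin; ring.
by apply: leeD; rewrite lee_pmul2l.
Qed.

Lemma wL2int_small (h : nat -> plane R -> C4 R) (e : R) :
  wL2norm (fun=> 1%R) (h n) @[n --> \oo] --> 0%E -> 0 < e ->
  exists N, forall n, (N <= n)%N ->
    (\int[leb2 R]_x ((1 * cnorm4 (h n x)) ^+ 2)%:E <= (e ^+ 2)%:E)%E.
Proof.
move=> + e0 => /(_ [set y | (y < e%:E)%E])[].
  by apply: open_ereal_lt'; rewrite lte_fin.
move=> N _ HN; exists N => n Nn; rewrite -(wL2norm_le _ _ (ltW e0)).
by apply: ltW; exact: HN.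
Qed.

(** Both functions are [L^2] limits of the same truncated integrals, so the integral of the square
    of their distance is below every positive number. *)
Lemma is_fourier_unique f g1 g2 : is_fourier f g1 -> is_fourier f g2 ->
  {ae leb2 R, forall x, g1 x = g2 x}.
Proof.
move=> [[mf _] [mg1 _] c1] [_ [mg2 _] c2].
have m1 : measurable_fun setT (cst 1 : plane R -> R) by [].
have M3 := measurable_wL2 m1 (measurable_C4B mg1 mg2).
have small (e : R) : 0 < e ->
    (\int[leb2 R]_x ((1 * cnorm4 (g1 x - g2 x)) ^+ 2)%:E <= (4 * e ^+ 2)%:E)%E.
  move=> e0.
  have [N1 H1] := wL2int_small c1 e0; have [N2 H2] := wL2int_small c2 e0.
  exact: (two_halves_le (wL2int_split (measurable_trunc_fourier (maxn N1 N2) mf) mg1 mg2)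
    (H1 _ (leq_maxl _ _)) (H2 _ (leq_maxr _ _))).
have int0 : (\int[leb2 R]_x ((1 * cnorm4 (g1 x - g2 x)) ^+ 2)%:E = 0)%E.
  apply/eqP; rewrite eq_le wL2int_ge0 andbT.
  apply/lee_addgt0Pr => e e0; rewrite add0e.
  have e4 : 0 < e / 4 by rewrite divr_gt0.
  (* This choice turns the bound [4 * e ^+ 2] of [small] into [e]. *)
  have := small (Num.sqrt (e / 4)); rewrite sqrtr_gt0 (sqr_sqrtr (ltW e4)) => /(_ e4).
  by rewrite mulrC divfK ?pnatr_eq0.
have : (\int[leb2 R]_x `| ((1 * cnorm4 (g1 x - g2 x)) ^+ 2)%:E | = 0)%E.
  by rewrite -int0; apply: eq_integral => x _; rewrite gee0_abs // lee_fin sqr_ge0.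
move/(ae_eq_integral_abs _ measurableT M3); apply: filterS => x /(_ I) /= [].
move/eqP; rewrite mul1r expf_eq0 /= => /eqP/cnorm4_eq0/eqP.
by rewrite subr_eq0 => /eqP.
Qed.

Lemma fourierP f g : is_fourier f g -> is_fourier f (fourier f).
Proof. by move=> fg; apply: (@xgetPex _ _ [set h | is_fourier f h]); exists g. Qed.

Lemma ae_eq_fourier f g : is_fourier f g -> {ae leb2 R, forall x, fourier f x = g x}.
Proof. by move=> fg; exact: is_fourier_unique (fourierP fg) fg. Qed.
End L2Limits.

(** * Truncated Fourier integrals depend only on the almost everywhere class *)

Section TruncatedFourier.
Variable R : realType.
Implicit Types (f g : plane R -> C4 R) (xi : plane R).

Lemma measurable_expNi_mul f xi : measurable_C4 f ->
  measurable_C4 (fun x => expNi (dotp x xi) *: f x).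
Proof.
move=> mf k; have [mRe mIm] := mf k.
have mdot : measurable_fun setT (fun x : plane R => dotp x xi).
  by apply: measurable_funD; apply: measurable_funM.
have mcos : measurable_fun setT (fun x : plane R => cos (dotp x xi)).
  exact: measurableT_comp (continuous_measurable_fun (@continuous_cos R)) mdot.
have msin : measurable_fun setT (fun x : plane R => sin (dotp x xi)).
  exact: measurableT_comp (continuous_measurable_fun (@continuous_sin R)) mdot.
split.
- have -> : (fun x => complex.Re ((expNi (dotp x xi) *: f x) k ord0))
     = (fun x => cos (dotp x xi) * complex.Re (f x k ord0)
          + sin (dotp x xi) * complex.Im (f x k ord0)).
    apply/funext => x; rewrite mxE; case: (f x k ord0) => p q /=.
    by rewrite mulNr opprK.
  by apply: measurable_funD; apply: measurable_funM.
- have -> : (fun x => complex.Im ((expNi (dotp x xi) *: f x) k ord0))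
     = (fun x => cos (dotp x xi) * complex.Im (f x k ord0)
          - sin (dotp x xi) * complex.Re (f x k ord0)).
    by apply/funext => x; rewrite mxE; case: (f x k ord0) => p q /=; ring.
  by apply: measurable_funB; apply: measurable_funM.
Qed.

Lemma integral_C4_ae (D : set (plane R)) f g : measurable D ->
  measurable_C4 f -> measurable_C4 g ->
  {ae leb2 R, forall x, f x = g x} -> integral_C4 D f = integral_C4 D g.
Proof.
move=> mD mf mg fg; apply/matrixP => k j; rewrite !mxE.
have [? ?] := mf k; have [? ?] := mg k.
congr Complex; congr fine; apply: ae_eq_integral => //.
- by apply: measurable_funTS; exact/measurable_EFinP.
- by apply: measurable_funTS; exact/measurable_EFinP.
- by apply: filterS fg => x -> _.
- by apply: measurable_funTS; exact/measurable_EFinP.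
- by apply: measurable_funTS; exact/measurable_EFinP.
- by apply: filterS fg => x -> _.
Qed.

Lemma trunc_fourier_ae n f g : measurable_C4 f -> measurable_C4 g ->
  {ae leb2 R, forall x, f x = g x} -> trunc_fourier n f = trunc_fourier n g.
Proof.
move=> mf mg fg; apply/funext => xi; apply: integral_C4_ae.
- exact: measurable_ball_enorm.
- exact: measurable_expNi_mul.
- exact: measurable_expNi_mul.
- by apply: filterS fg => x ->.
Qed.

(** A solution takes the initial value only almost everywhere; this makes [W 0] a Fourier transform
    of [U0] itself. *)
Lemma is_fourier_ae f g h : L2_fun g -> {ae leb2 R, forall x, f x = g x} ->
  is_fourier f h -> is_fourier g h.
Proof.
move=> L2g fg [[mf _] L2h fh].
have E n := trunc_fourier_ae n mf L2g.1 fg.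
split; [exact: L2g | exact: L2h |].
have -> : (fun n => wL2norm (fun=> 1%R) (fun xi => trunc_fourier n g xi - h xi))
  = (fun n => wL2norm (fun=> 1%R) (fun xi => trunc_fourier n f xi - h xi)).
  by apply/funext => n; rewrite E.
exact: fh.
Qed.

End TruncatedFourier.

(** The majorant [h] provides the integrability of [p] and [q], while the separate constant [C],
    which may be small, measures their distance. *)
Lemma Rintegral_dist_le (R : realType) d (T : measurableType d)
    (mu : {measure set T -> \bar R}) (p q h : T -> R) (C : R) :
  measurable_fun setT p -> measurable_fun setT q ->
  mu.-integrable setT (EFin \o h) ->
  (forall x, `|p x| <= h x) -> (forall x, `|q x| <= h x) ->
  (forall x, `|p x - q x| <= C * h x) ->
  `|\int[mu]_x p x - \int[mu]_x q x| <= C * \int[mu]_x h x.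
Proof.
move=> mp mq ih ph qh pqh.
have ip : mu.-integrable setT (EFin \o p).
  apply: (le_integrable measurableT _ _ ih); first exact/measurable_EFinP.
  move=> x _ /=; rewrite lee_fin; apply: le_trans (ph x) _; exact: ler_norm.
have iq : mu.-integrable setT (EFin \o q).
  apply: (le_integrable measurableT _ _ ih); first exact/measurable_EFinP.
  move=> x _ /=; rewrite lee_fin; apply: le_trans (qh x) _; exact: ler_norm.
have ipq : mu.-integrable setT (EFin \o (fun x => p x - q x)).
  have -> : EFin \o (fun x => p x - q x) = ((EFin \o p) \- (EFin \o q))%E by [].
  exact: integrableB.
rewrite -RintegralB // -RintegralZl //.
apply: (le_trans (le_normr_Rintegral measurableT ipq)).
apply: le_Rintegral => //; first exact: (integrable_norm ipq).
have -> : EFin \o (fun x => C * h x) = (fun x => C%:E * (h x)%:E)%E by [].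
exact: integrableZl.
Qed.

(** * Hölder bounds for the oscillating factor of the Fourier integral *)

Section OscillationBounds.
Variable R : realType.
Implicit Types (y g c : R) (x xi : plane R).

Lemma normr_sin_le y : `|sin y| <= `|y|.
Proof.
wlog y0 : y / 0 <= y => [hw|].
  have [/hw //|/ltW y0] := leP 0 y.
  by have := hw (- y); rewrite oppr_ge0 sinN !normrN; apply.
have [c _] := @MVT_segment R sin cos 0 y y0 (fun z _ => is_derive_sin z)
  (continuous_subspaceT (@continuous_sin R)).
rewrite sin0 !subr0 => ->; rewrite normrM ler_piMl ?normr_ge0 //.
exact: cos_max.
Qed.

(** By the half-angle formula the left side is [2 * sin (y / 2) ^+ 2]; one sine is bounded by
    [|y| / 2], the other by 1. *)
Lemma normr_cosB1_le y : `|cos y - 1| <= `|y|.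
Proof.
have -> : cos y - 1 = - (2 * sin (y / 2) ^+ 2).
  have := cos2sin2 (y / 2); have := cosD (y / 2) (y / 2).
  rewrite -splitr => ->; rewrite -!expr2 => ->; ring.
rewrite normrN normrM normrX ger0_norm // expr2.
have h1 := normr_sin_le (y / 2); have h2 := sin_max (y / 2).
rewrite normrM (ger0_norm (_ : 0 <= 2^-1)) ?invr_ge0 // in h1.
have := normr_ge0 (sin (y / 2)); nra.
Qed.

Lemma le_normr_powR g y : 0 < g -> g <= 1 -> `|y| <= 1 -> `|y| <= `|y| `^ g.
Proof.
move=> g0 g1 y1; have := normr_ge0 y; rewrite le_eqVlt => /predU1P[<-|y0].
  exact: powR_ge0.
by rewrite -[leLHS]powRr1 // ger_powR // y0 y1.
Qed.

Lemma one_le_normr_powR g y : 0 < g -> 1 <= `|y| -> 1 <= `|y| `^ g.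
Proof. by move=> g0 y1; rewrite -(powRr0 `|y|) ler_powR // ltW. Qed.

(** Interpolation between the bounds [|y|] and 1; for [|y| <= 1] it is [g <= 1] that makes the power
    dominate [|y|]. *)
Lemma sin_le_powR g y : 0 < g -> g <= 1 -> `|sin y| <= `|y| `^ g.
Proof.
move=> g0 g1; have [y1|/ltW y1] := leP `|y| 1.
  exact: le_trans (normr_sin_le y) (le_normr_powR g0 g1 y1).
exact: le_trans (sin_max y) (one_le_normr_powR g0 y1).
Qed.

Lemma cosB1_le_powR g y : 0 < g -> g <= 1 -> `|cos y - 1| <= 2 * `|y| `^ g.
Proof.
move=> g0 g1; have p0 := powR_ge0 `|y| g.
have [y1|/ltW y1] := leP `|y| 1.
  have := normr_cosB1_le y; have := le_normr_powR g0 g1 y1; lra.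
have := one_le_normr_powR g0 y1.
have : `|cos y - 1| <= 2.
  apply: (le_trans (ler_normB _ _)); rewrite normr1; have := cos_max y; lra.
lra.
Qed.

Lemma dotp_le x xi : `|dotp x xi| <= enorm x * enorm xi.
Proof.
rewrite -sqrtrM ?addr_ge0 ?sqr_ge0 // -sqrtr_sqr ler_wsqrtr // /dotp.
(* Lagrange's identity: this square is the defect in the Cauchy-Schwarz inequality. *)
have := sqr_ge0 (x.1 * xi.2 - x.2 * xi.1); nra.
Qed.

Lemma normr_Re_le (v : C4 R) k : `|complex.Re (v k ord0)| <= cnorm4 v.
Proof.
rewrite -sqrtr_sqr ler_wsqrtr // (bigD1 k) //= -addrA lerDl.
by rewrite addr_ge0 ?sqr_ge0 // sumr_ge0 // => j _; rewrite addr_ge0 ?sqr_ge0.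
Qed.

Lemma normr_Im_le (v : C4 R) k : `|complex.Im (v k ord0)| <= cnorm4 v.
Proof.
rewrite -sqrtr_sqr ler_wsqrtr // (bigD1 k) //= addrAC lerDr.
by rewrite addr_ge0 ?sqr_ge0 // sumr_ge0 // => j _; rewrite addr_ge0 ?sqr_ge0.
Qed.

Lemma cnorm4_expNi y (v : C4 R) : cnorm4 (expNi y *: v) = cnorm4 v.
Proof.
congr Num.sqrt; apply: eq_bigr => k _; rewrite mxE.
case: (v k ord0) => p q /=; have := cos2Dsin2 y.
move: (cos y) (sin y) => c s cs; rewrite -[RHS]mul1r -cs; ring.
Qed.

(** The factor [expNi y - 1] is bounded by [|y|] to the power [g], with constant 2 from the cosine
    and 1 from the sine, and [|y| <= |x| |xi|] by Cauchy-Schwarz. The power of [|x|] is absorbed by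
    the weight. *)
Lemma expNiB1_le g x xi (v : C4 R) k : 0 < g -> g <= 1 ->
  `|complex.Re ((expNi (dotp x xi) *: v) k ord0) - complex.Re (v k ord0)|
    <= 3 * enorm xi `^ g * ((1 + enorm x) `^ g * cnorm4 v) /\
  `|complex.Im ((expNi (dotp x xi) *: v) k ord0) - complex.Im (v k ord0)|
    <= 3 * enorm xi `^ g * ((1 + enorm x) `^ g * cnorm4 v).
Proof.
move=> g0 g1.
have hc := cosB1_le_powR (dotp x xi) g0 g1; have hs := sin_le_powR (dotp x xi) g0 g1.
have yle : `|dotp x xi| `^ g <= enorm xi `^ g * (1 + enorm x) `^ g.
  have e0 : 0 <= 1 + enorm x by rewrite addr_ge0 ?enorm_ge0.
  rewrite -powRM ?enorm_ge0 //.
  apply: ge0_ler_powR; rewrite ?nnegrE ?(ltW g0) ?normr_ge0 ?mulr_ge0 ?enorm_ge0 //.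
  apply: (le_trans (dotp_le x xi)); rewrite mulrC.
  by rewrite ler_wpM2l ?enorm_ge0 // lerDr.
have hRe := normr_Re_le v k; have hIm := normr_Im_le v k.
rewrite mxE; move: hRe hIm; case: (v k ord0) => p q /= hp hq.
move: hc hs yle; move: (dotp x xi) => y hc hs yle.
have P0 := powR_ge0 `|y| g; have V0 := cnorm4_ge0 v.
have K u w : `|u| <= cnorm4 v -> `|w| <= cnorm4 v ->
   `|(cos y - 1) * u| + `|sin y * w| <= 3 * enorm xi `^ g * ((1 + enorm x) `^ g * cnorm4 v).
  move=> hu hw; rewrite !normrM.
  apply: (@le_trans _ _ (2 * `|y| `^ g * cnorm4 v + `|y| `^ g * cnorm4 v)).
    by apply: lerD; apply: ler_pM.
  have -> : 2 * `|y| `^ g * cnorm4 v + `|y| `^ g * cnorm4 v = 3 * cnorm4 v * `|y| `^ g by ring.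
  have -> : 3 * enorm xi `^ g * ((1 + enorm x) `^ g * cnorm4 v)
     = 3 * cnorm4 v * (enorm xi `^ g * (1 + enorm x) `^ g) by ring.
  by rewrite ler_wpM2l // mulr_ge0.
split.
- have -> : cos y * p - - sin y * q - p = (cos y - 1) * p + sin y * q by ring.
  exact: le_trans (ler_normD _ _) (K _ _ hp hq).
- have -> : cos y * q + - sin y * p - q = (cos y - 1) * q - sin y * p by ring.
  exact: le_trans (ler_normB _ _) (K _ _ hq hp).
Qed.
End OscillationBounds.

(** * Low-frequency bound for the truncated Fourier integrals *)

Section TruncatedFourierBound.
Variables (R : realType) (g : R) (f : plane R -> C4 R).
Hypotheses (g_gt0 : 0 < g) (g_le1 : g <= 1) (fL1 : in_L1w g f).
Implicit Types (x xi : plane R).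

Let h x := (1 + enorm x) `^ g * cnorm4 (f x).
Let M := fine (L1w_norm g f).

Lemma measurable_weight : measurable_fun setT h.
Proof.
apply: measurable_funM; last exact: measurable_cnorm4 fL1.1.
apply: (measurableT_comp (measurable_powR g)).
by apply: measurable_funD => //; exact: measurable_enorm.
Qed.

Lemma weight_ge1 x : 1 <= (1 + enorm x) `^ g.
Proof. by rewrite -[leLHS](powRr0 (1 + enorm x)) ler_powR ?(ltW g_gt0) // lerDl enorm_ge0. Qed.

Lemma integrable_weight : (leb2 R).-integrable setT (EFin \o h).
Proof.
apply/integrableP; split; first by apply/measurable_EFinP; exact: measurable_weight.
have [_] := fL1; rewrite /L1w_norm; congr (_ < _)%E.
apply: eq_integral => x _; rewrite gee0_abs // lee_fin mulr_ge0 ?powR_ge0 //.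
exact: cnorm4_ge0.
Qed.

(** Used with [P] the real or the imaginary part of one component. Inside the ball the oscillation
    bound applies; outside only [P (f x)] is left, and there the weight is at least [(1 + n) ^ g],
    which gives the truncation error [(1 + n) ^ (- g)]. *)
Lemma component_dist_le n xi (P : C4 R -> R) :
  measurable_fun setT (P \o f) ->
  measurable_fun setT (fun x => P (expNi (dotp x xi) *: f x)) ->
  (forall v, `|P v| <= cnorm4 v) ->
  (forall x, `|P (expNi (dotp x xi) *: f x) - P (f x)| <= 3 * enorm xi `^ g * h x) ->
  `|\int[leb2 R]_(x in [set x | enorm x <= n%:R]) P (expNi (dotp x xi) *: f x)
    - \int[leb2 R]_x P (f x)| <= (3 * enorm xi `^ g + (1 + n%:R) `^ (- g)) * M.
Proof.
move=> mq mp Pv PD; rewrite Rintegral_mkcond.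
have fh x : cnorm4 (f x) <= h x by rewrite ler_peMl ?weight_ge1 ?cnorm4_ge0.
have h0 x : 0 <= h x := le_trans (cnorm4_ge0 _) (fh x).
have r0 : 0 <= 3 * enorm xi `^ g by rewrite mulr_ge0 ?powR_ge0.
have n0 := powR_ge0 (1 + n%:R : R) (- g).
apply: (@Rintegral_dist_le _ _ _ _ _ _ h).
- by apply/(measurable_restrictT _ (measurable_ball_enorm n)); exact: measurable_funTS.
- exact: mq.
- exact: integrable_weight.
- move=> x; rewrite patchE; case: ifPn => _; last by rewrite normr0.
  by apply: (le_trans (Pv _)); rewrite cnorm4_expNi.
- by move=> x; apply: le_trans (Pv _) _.
- move=> x; rewrite patchE mulrDl; case: ifPn => [_|].
    by rewrite ler_wpDr ?(mulr_ge0 n0).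
  rewrite notin_setE /= => /negP; rewrite -ltNge => nx.
  rewrite sub0r normrN ler_wpDl ?(mulr_ge0 r0) //.
  apply: le_trans (Pv _) _; rewrite /h mulrA ler_peMl ?cnorm4_ge0 //.
  rewrite powRN mulrC ler_pdivlMr ?mul1r; last by rewrite powR_gt0 // ltr_pwDl.
  by apply: ge0_ler_powR; rewrite ?nnegrE ?(ltW g_gt0) ?addr_ge0 ?enorm_ge0 // lerD2l ltW.
Qed.

(** Each of the eight real components is within [C] of that of the full integral of [f], so its
    square gains at most [2 * C ^+ 2]; this is the factor 16. *)
Lemma trunc_fourier_le n xi :
  cnorm4 (trunc_fourier n f xi) ^+ 2 <=
  2 * cnorm4 (integral_C4 setT f) ^+ 2
  + 16 * (3 * enorm xi `^ g + (1 + n%:R) `^ (- g)) ^+ 2 * M ^+ 2.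
Proof.
have sq (a b c : R) : `|a - b| <= c -> a ^+ 2 <= 2 * b ^+ 2 + 2 * c ^+ 2.
  move=> abc; have c0 := le_trans (normr_ge0 _) abc.
  have : (a - b) ^+ 2 <= c ^+ 2.
    by rewrite -[leLHS]real_normK ?num_real // lerXn2r // nnegrE.
  by have := sqr_ge0 (a - 2 * b); nra.
have mf := fL1.1; have me := measurable_expNi_mul xi mf.
pose C := (3 * enorm xi `^ g + (1 + n%:R) `^ (- g)) * M.
have -> : 16 * (3 * enorm xi `^ g + (1 + n%:R) `^ (- g)) ^+ 2 * M ^+ 2
   = \sum_(k < 4) (2 * C ^+ 2 + 2 * C ^+ 2).
  by rewrite big_ord4 /C; ring.
rewrite !cnorm4_sq mulr_sumr -big_split /=; apply: ler_sum => k _.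
rewrite !mxE /= mulrDr addrACA; apply: lerD; apply: sq.
- apply: (component_dist_le n (P := fun v => complex.Re (v k ord0))).
  + exact: (mf k).1.
  + exact: (me k).1.
  + by move=> v; exact: normr_Re_le.
  + by move=> x; exact: (expNiB1_le x xi (f x) k g_gt0 g_le1).1.
- apply: (component_dist_le n (P := fun v => complex.Im (v k ord0))).
  + exact: (mf k).2.
  + exact: (me k).2.
  + by move=> v; exact: normr_Im_le.
  + by move=> x; exact: (expNiB1_le x xi (f x) k g_gt0 g_le1).2.
Qed.
End TruncatedFourierBound.

(** * Integrals of exponentials over the line and the plane *)

Section ExponentialIntegrals.
Variable R : realType.
Implicit Types c : R.

Lemma continuous_expR_norm c : continuous (fun x : R => expR (- c * `|x|)).
Proof.
move=> x; apply: continuous_comp; last exact: continuous_expR.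
by apply: cvgMr; exact: norm_continuous.
Qed.

(** By evenness this is twice the integral over the half-line, where the integrand is [c^-1] times
    the exponential density, of total mass 1. *)
Lemma integral_expR_norm c : 0 < c ->
  (\int[@lebesgue_measure R]_x (expR (- c * `|x|))%:E = (2 / c)%:E)%E.
Proof.
move=> c0; have c1 : 0 <= c^-1 by rewrite invr_ge0 ltW.
rewrite ge0_symfun_integralT.
- rewrite integral_mkcond.
  have -> : ((fun x => (expR (- c * `|x|))%:E) \_ [set x : R | 0 <= x])
     = (fun x => c^-1%:E * (exponential_pdf c x)%:E)%E.
    apply/funext => x; rewrite patchE /exponential_pdf patchE set_itvcy.
    case: ifPn => [|_]; last by rewrite mule0.
    rewrite inE /= => x0; rewrite -EFinM mulrA mulVf ?gt_eqF // mul1r.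
    by rewrite ger0_norm.
  rewrite ge0_integralZl //=.
  + by rewrite integral_exponential_pdf // mule1 -EFinM.
  + by apply/measurable_EFinP; exact: measurable_exponential_pdf.
  + by move=> x _; rewrite lee_fin exponential_pdf_ge0 // ltW.
- by move=> x; exact: expR_ge0.
- exact: continuous_expR_norm.
- by move=> x /=; rewrite normrN.
Qed.

Lemma measurable_expR_norms c : measurable_fun setT
  (fun x : plane R => expR (- c * `|x.1|) * expR (- c * `|x.2|)).
Proof.
have m := continuous_measurable_fun (@continuous_expR_norm c).
by apply: measurable_funM; apply: (measurableT_comp m).
Qed.

Lemma integral_expR_norms c : 0 < c ->
  (\int[leb2 R]_x (expR (- c * `|x.1|) * expR (- c * `|x.2|))%:E = ((2 / c) ^+ 2)%:E)%E.
Proof.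
move=> c0.
have m := continuous_measurable_fun (@continuous_expR_norm c).
rewrite (@fubini_tonelli1 _ _ _ _ R lebesgue_measure lebesgue_measure
  (fun x => (expR (- c * `|x.1|) * expR (- c * `|x.2|))%:E)); last 2 first.
- by apply/measurable_EFinP; exact: measurable_expR_norms.
- by move=> x; rewrite lee_fin mulr_ge0 ?expR_ge0.
rewrite /fubini_F /=.
have meas : measurable_fun setT (fun x : R => (expR (- c * `|x|))%:E) by exact/measurable_EFinP.
have pos (x : R) : setT x -> (0 <= (expR (- c * `|x|))%:E)%E.
  by move=> _; rewrite lee_fin expR_ge0.
have scale (k : R) : 0 <= k ->
    (\int[@lebesgue_measure R]_x (k%:E * (expR (- c * `|x|))%:E) = (k * (2 / c))%:E)%E.
  move=> k0; rewrite EFinM -(integral_expR_norm c0).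
  by apply: ge0_integralZl => //; rewrite lee_fin.
transitivity (\int[@lebesgue_measure R]_x ((2 / c)%:E * (expR (- c * `|x|))%:E))%E.
  apply: eq_integral => x _; rewrite -EFinM (mulrC (2 / c)) -scale ?expR_ge0 //.
by rewrite scale ?expr2 // divr_ge0 // ltW.
Qed.
End ExponentialIntegrals.

(** Integrates the four-term bound of [energy_pointwise]. All terms are nonnegative, so the
    integrals may be infinite. *)
Lemma ae_integral_lin4_le (R : realType) d (T : measurableType d)
    (mu : {measure set T -> \bar R}) (f f1 f2 f3 f4 : T -> R) (c1 c2 c3 c4 : R) :
  measurable_fun setT f -> measurable_fun setT f1 -> measurable_fun setT f2 ->
  measurable_fun setT f3 -> measurable_fun setT f4 ->
  (forall x, 0 <= f x) -> (forall x, 0 <= f1 x) -> (forall x, 0 <= f2 x) ->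
  (forall x, 0 <= f3 x) -> (forall x, 0 <= f4 x) ->
  0 <= c1 -> 0 <= c2 -> 0 <= c3 -> 0 <= c4 ->
  {ae mu, forall x, f x <= c1 * f1 x + c2 * f2 x + c3 * f3 x + c4 * f4 x} ->
  (\int[mu]_x (f x)%:E <=
     c1%:E * \int[mu]_x (f1 x)%:E + c2%:E * \int[mu]_x (f2 x)%:E
     + c3%:E * \int[mu]_x (f3 x)%:E + c4%:E * \int[mu]_x (f4 x)%:E)%E.
Proof.
move=> mf m1 m2 m3 m4 f0 p1 p2 p3 p4 q1 q2 q3 q4 H.
have Z (c : R) (g : T -> R) : measurable_fun setT g -> (forall x, 0 <= g x) -> 0 <= c ->
    (c%:E * \int[mu]_x (g x)%:E = \int[mu]_x (c * g x)%:E)%E.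
  move=> mg g0 c0; under [RHS]eq_integral do rewrite EFinM.
  rewrite ge0_integralZl // ?lee_fin //; first exact/measurable_EFinP.
  by move=> x _; rewrite lee_fin.
have D : forall g h : T -> R, measurable_fun setT g -> measurable_fun setT h ->
    (forall x, 0 <= g x) -> (forall x, 0 <= h x) ->
    (\int[mu]_x (g x)%:E + \int[mu]_x (h x)%:E = \int[mu]_x (g x + h x)%:E)%E.
  move=> g h mg mh g0 h0; under [RHS]eq_integral do rewrite EFinD.
  by rewrite ge0_integralD //; first [exact/measurable_EFinP | by move=> x _; rewrite lee_fin].
have mM (c : R) (g : T -> R) : measurable_fun setT g -> measurable_fun setT (fun x => c * g x).
  by move=> mg; apply: measurable_funM.
have P (c : R) (g : T -> R) : (forall x, 0 <= g x) -> 0 <= c -> forall x, 0 <= c * g x.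
  by move=> g0 c0 x; rewrite mulr_ge0.
have mA : forall g h : T -> R, measurable_fun setT g -> measurable_fun setT h ->
    measurable_fun setT (fun x => g x + h x) by move=> g h mg mh; exact: measurable_funD.
have A : forall g h : T -> R, (forall x, 0 <= g x) -> (forall x, 0 <= h x) ->
    forall x, 0 <= g x + h x by move=> g h g0 h0 x; rewrite addr_ge0.
rewrite !Z // !D //;
  try solve [by move=> x; do ?apply: addr_ge0; apply: mulr_ge0
    | by repeat (apply: measurable_funD); apply: mM | exact: mM].
apply: ae_ge0_le_integral => //.
- by move=> x _; rewrite lee_fin.
- exact/measurable_EFinP.
- by move=> x _; rewrite lee_fin !addr_ge0 ?mulr_ge0.
- by apply/measurable_EFinP; repeat (apply: measurable_funD); apply: mM.
- by apply: filterS H => x Hx _; rewrite lee_fin.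
Qed.

(** * Decay in time of the low-frequency integrals *)

Section LowFrequency.
Variable R : realType.
Implicit Types (sigma k m t : R) (xi : plane R).

Definition unit_disc : set (plane R) := [set xi | enorm xi <= 1].

Lemma measurable_unit_disc : measurable unit_disc.
Proof. exact: (@measurable_ball_enorm R 1). Qed.

Lemma measurable_enorm_powR sigma : measurable_fun setT (fun xi => enorm xi `^ sigma).
Proof. exact: measurableT_comp (measurable_powR sigma) (@measurable_enorm R). Qed.

(** A weight for squared amplitudes, hence the exponent [2 * sigma]: a diffusion of order [m], cut
    off to the unit disc. *)
Definition low_weight sigma k m t xi :=
  \1_unit_disc xi * (enorm xi `^ (2 * sigma) * expR (- (k * enorm xi `^ m * t))).

Lemma low_weight_ge0 sigma k m t xi : 0 <= low_weight sigma k m t xi.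
Proof. by rewrite !mulr_ge0 ?powR_ge0 ?expR_ge0 // indicE. Qed.

Lemma measurable_low_weight sigma k m t : measurable_fun setT (low_weight sigma k m t).
Proof.
apply: measurable_funM; first exact: measurable_indic measurable_unit_disc.
apply: measurable_funM; first exact: measurable_enorm_powR.
apply: (measurableT_comp (@measurable_expR R)).
apply: measurableT_comp => //; apply: measurable_funM => //.
by apply: measurable_funM => //; exact: measurable_enorm_powR.
Qed.

(** With [tau = (1 + t) ^ (1 / m)], the weight contributes [tau ^ (- 2 sigma)] and the integral over
    the plane a further [tau ^ (- 2)], one factor per dimension. *)
Lemma low_weight_integral_le sigma k m : 0 <= sigma -> 0 < k -> 1 < m ->
  exists2 K : R, 0 < K & forall t, 0 <= t ->
    (\int[leb2 R]_xi (low_weight sigma k m t xi)%:E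
       <= (K * (1 + t) `^ (- ((2 * sigma + 2) / m)))%:E)%E.
Proof.
move=> s0 k0 m1; have [K K0 HK] := diffusion_le_exp s0 k0 m1.
exists (K * (2 / (k / 4)) ^+ 2).
  by rewrite mulr_gt0 // exprn_gt0 // divr_gt0 // divr_gt0.
move=> t t0; have t1 : 0 < 1 + t by rewrite ltr_pwDl.
pose tau := (1 + t) `^ m^-1.
have tau0 : 0 < tau by rewrite powR_gt0.
have c0 : 0 < k / 4 * tau by rewrite mulr_gt0 // divr_gt0.
have KT0 : 0 <= K * tau `^ (- (2 * sigma)) by rewrite mulr_ge0 ?(ltW K0) ?powR_ge0.
pose F xi := expR (- (k / 4 * tau) * `|xi.1|) * expR (- (k / 4 * tau) * `|xi.2|).
have F0 xi : 0 <= F xi by rewrite mulr_ge0 ?expR_ge0.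
have mF : measurable_fun setT (EFin \o F).
  by apply/measurable_EFinP; exact: measurable_expR_norms (k / 4 * tau).
apply: (@le_trans _ _ (\int[leb2 R]_xi ((K * tau `^ (- (2 * sigma)))%:E * (F xi)%:E))%E).
  apply: ge0_le_integral => //.
  - by move=> xi _; rewrite lee_fin low_weight_ge0.
  - by apply/measurable_EFinP; exact: measurable_low_weight.
  - exact: (measurable_funeM _ mF).
  - move=> xi _; rewrite -EFinM lee_fin /low_weight indicE.
    have [|] := boolP (xi \in unit_disc); last by rewrite mul0r mulr_ge0.
    by rewrite inE mul1r => xi1; exact: HK.
rewrite (ge0_integralZl _ measurableT mF) //; last by move=> xi _; rewrite lee_fin.
rewrite integral_expR_norms // -EFinM lee_fin.
have -> : (1 + t) `^ (- ((2 * sigma + 2) / m)) = tau `^ (- (2 * sigma)) / tau ^+ 2.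
  rewrite -(powR_mulrn 2 (ltW tau0)) -powRB ?(gt_eqF tau0) ?implybT //.
  by rewrite -powRrM; congr (_ `^ _); ring.
rewrite le_eqVlt; apply/orP; left; apply/eqP; field.
by rewrite !gt_eqF.
Qed.
End LowFrequency.

(** * The energy estimate, first at one frequency and then integrated *)

Section EnergyEstimate.
Variables (R : realType) (rho theta s g kappa : R).
Hypotheses (rho_ge0 : 0 <= rho) (rho_lt : rho < 2^-1).
Hypotheses (theta_gt : 2^-1 < theta) (theta_le1 : theta <= 1).
Hypotheses (s_ge0 : 0 <= s) (g_gt0 : 0 < g) (g_le1 : g <= 1) (kappa_gt0 : 0 < kappa).
Implicit Types (xi : plane R) (t : R).

Let m := 2 - 2 * rho.
Let k := kappa / 2.

Let k_gt0 : 0 < k. Proof. by rewrite divr_gt0. Qed.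

Lemma decay_low t xi : 0 <= t -> enorm xi <= 1 ->
  expR (- (kappa * (enorm xi ^+ 2 / damping rho theta (enorm xi)) * t))
    <= expR (- (k * enorm xi `^ m * t)).
Proof.
move=> t0 r1; rewrite ler_expR lerN2 ler_wpM2r //.
have -> : k * enorm xi `^ m = kappa * (enorm xi `^ m / 2) by rewrite /k; ring.
by rewrite ler_pM2l // rate_low // enorm_ge0.
Qed.

Lemma decay_high t xi : 0 <= t -> 1 <= enorm xi ->
  expR (- (kappa * (enorm xi ^+ 2 / damping rho theta (enorm xi)) * t))
    <= expR (- (k * t)).
Proof.
move=> t0 r1; rewrite ler_expR lerN2 ler_wpM2r //.
by rewrite /k ler_pM2l // rate_high.
Qed.

(** Here [u], [v], [T] stand for [W(t, xi)], [W_0(xi)] and the truncated integral, and [ep] for the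
    truncation error. For [|xi| > 1] only the last term counts. For [|xi| <= 1], [v] is replaced by
    [T] at the cost of [T - v], whose multiplier is bounded by 1. *)
Lemma energy_pointwise t xi (P M ep : R) (u v T : C4 R) : 0 <= t ->
  cnorm4 u ^+ 2 <=
    3 * expR (- (kappa * (enorm xi ^+ 2 / damping rho theta (enorm xi)) * t))
      * cnorm4 v ^+ 2 ->
  cnorm4 T ^+ 2 <= 2 * P ^+ 2 + 16 * (3 * enorm xi `^ g + ep) ^+ 2 * M ^+ 2 ->
  (enorm xi `^ s * cnorm4 u) ^+ 2 <=
    (12 * P ^+ 2 + 192 * ep ^+ 2 * M ^+ 2) * low_weight s k m t xi
    + 1728 * M ^+ 2 * low_weight (s + g) k m t xi
    + 6 * (1 * cnorm4 (T - v)) ^+ 2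
    + 3 * expR (- (k * t)) * ((1 + enorm xi ^+ 2) `^ (s / 2) * cnorm4 v) ^+ 2.
Proof.
move=> t0 uv TP; set r := enorm xi; have r0 : 0 <= r := enorm_ge0 xi.
have E0 := expR_ge0 (- (k * t)).
have p0 := powR_ge0 r s.
have D0 : 0 <= 6 * (1 * cnorm4 (T - v)) ^+ 2 by rewrite mulr_ge0 ?sqr_ge0.
have H0 : 0 <= 3 * expR (- (k * t)) * ((1 + r ^+ 2) `^ (s / 2) * cnorm4 v) ^+ 2.
  by rewrite mulr_ge0 ?sqr_ge0 // mulr_ge0.
have rs2 : (r `^ s) ^+ 2 = r `^ (2 * s).
  by rewrite -powR_mulrn // -powRrM mulrC.
rewrite exprMn rs2; have p20 := powR_ge0 r (2 * s).
have [r1|r1] := leP r 1; last first.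
  have L0 s' : low_weight s' k m t xi = 0.
    rewrite /low_weight indicE memNset ?mul0r //= => /(lt_le_trans r1).
    by rewrite ltxx.
  rewrite !L0 !mulr0 !add0r; apply: ler_wpDl => //.
  apply: (le_trans (ler_wpM2l p20 uv)).
  have hs : r `^ (2 * s) <= ((1 + r ^+ 2) `^ (s / 2)) ^+ 2.
    have q0 : 0 <= 1 + r ^+ 2 by rewrite addr_ge0 ?sqr_ge0.
    rewrite -powR_mulrn ?powR_ge0 // -powRrM (divfK (_ : 2 != 0)) ?pnatr_eq0 //.
    rewrite powRrM powR_mulrn // ge0_ler_powR ?nnegrE ?sqr_ge0 //.
    by rewrite lerDr.
  have dh := decay_high t0 (ltW r1).
  rewrite exprMn; move: dh hs p20 E0; rewrite -/r.
  set d := expR (- (kappa * _ * t)); set e := expR _; set p := r `^ (2 * s).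
  move: (_ `^ (s / 2)) (cnorm4 v) => A V dh hs p20 E0.
  have -> : 3 * e * (A ^+ 2 * V ^+ 2) = A ^+ 2 * (3 * e * V ^+ 2) by ring.
  apply: ler_pM => //; first by rewrite mulr_ge0 ?sqr_ge0 // mulr_ge0 ?expR_ge0.
  by rewrite ler_wpM2r ?sqr_ge0 // ler_wpM2l.
have L1 s' : low_weight s' k m t xi = r `^ (2 * s') * expR (- (k * r `^ m * t)).
  by rewrite /low_weight indicE mem_set // mul1r.
have e0 := expR_ge0 (- (k * r `^ m * t)).
have e1 : expR (- (k * r `^ m * t)) <= 1.
  rewrite -expR0 ler_expR oppr_le0 !mulr_ge0 ?powR_ge0 //; exact: ltW.
have p1 : r `^ (2 * s) <= 1.
  have := ge0_ler_powR (mulr_ge0 (ler0n _ 2) s_ge0) r0 ler01 r1.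
  by rewrite powR1; exact.
apply: ler_wpDr => //.
rewrite !L1.
have -> : r `^ (2 * (s + g)) = r `^ (2 * s) * (r `^ g) ^+ 2.
  rewrite -[in RHS]powR_mulrn ?powR_ge0 // -powRrM mulrDr.
  rewrite powRD; first by rewrite (mulrC g).
  by apply/implyP => /eqP sg0; exfalso; move: s_ge0 g_gt0; lra.
have uv' : cnorm4 u ^+ 2 <= 3 * expR (- (k * r `^ m * t)) * cnorm4 v ^+ 2.
  apply: (le_trans uv); rewrite ler_wpM2r ?sqr_ge0 // ler_wpM2l //.
  exact: decay_low.
have vT : cnorm4 v ^+ 2 <= 2 * cnorm4 T ^+ 2 + 2 * cnorm4 (T - v) ^+ 2.
  have -> : cnorm4 v = cnorm4 (T + - (T - v)) by rewrite opprB addrC subrK.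
  by rewrite -[in leRHS](cnorm4N (T - v)); exact: cnorm4D_sq.
move: uv' vT TP e0 e1 p20 p1; rewrite -/r.
set V := cnorm4 v ^+ 2; set U := cnorm4 u ^+ 2; set TT := cnorm4 T ^+ 2.
rewrite mul1r; set W := cnorm4 (T - v) ^+ 2.
set e := expR _; set p := r `^ (2 * s); set q := r `^ g.
have W0 : 0 <= W by rewrite sqr_ge0.
move=> uv' vT TP e0 e1 p20 p1.
(* Uses [(3 q + ep)^2 <= 18 q^2 + 2 ep^2]. The factor 2 of [vT] and the factor 3 of the decay then
   lead to the constants 12, 1728, 192 and 6. *)
have TP' : TT <= 2 * P ^+ 2 + 288 * q ^+ 2 * M ^+ 2 + 32 * ep ^+ 2 * M ^+ 2.
  apply: (le_trans TP).
  have := mulr_ge0 (sqr_ge0 (3 * q - ep)) (sqr_ge0 M); nra.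
have pe0 : 0 <= p * e by rewrite mulr_ge0.
have pe1 : p * e <= 1 by rewrite mulr_ile1.
apply: (le_trans (ler_wpM2l p20 uv')).
have -> : p * (3 * e * V) = 3 * (p * e) * V by ring.
apply: (@le_trans _ _ (3 * (p * e) * (4 * P ^+ 2 + 576 * q ^+ 2 * M ^+ 2
    + 64 * ep ^+ 2 * M ^+ 2 + 2 * W))).
  by rewrite ler_wpM2l ?mulr_ge0 //; lra.
have : p * e * W <= W by rewrite ler_piMl.
clearbody p e W q; move: (P ^+ 2) (M ^+ 2) (q ^+ 2) (ep ^+ 2) => P2 M2 q2 ep2; nra.
Qed.
End EnergyEstimate.

Lemma powRN_small (R : realType) (g e : R) : 0 < g -> 0 < e ->
  exists N : nat, forall n, (N <= n)%N -> (1 + n%:R) `^ (- g) <= e.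
Proof.
move=> g0 e0; exists (Num.bound (e^-1 `^ g^-1)) => n nN.
have p0 := powR_ge0 e^-1 g^-1.
have e1 : 0 < e^-1 by rewrite invr_gt0.
have big : e^-1 `^ g^-1 <= 1 + n%:R.
  apply: (@le_trans _ _ n%:R); last by rewrite lerDr.
  apply: ltW; apply: (lt_le_trans (archi_boundP p0)); by rewrite ler_nat.
rewrite powRN -[leRHS]invrK lef_pV2 ?posrE ?invr_gt0 ?powR_gt0 ?ltr_pwDl //.
have := ge0_ler_powR (ltW g0) _ _ big; rewrite -powRrM mulVf ?gt_eqF // powRr1 ?(ltW e1) //.
by apply; rewrite nnegrE // addr_ge0.
Qed.

Section EnergyIntegral.
Variables (R : realType) (rho theta s g kappa : R).
Hypotheses (rho_ge0 : 0 <= rho) (rho_lt : rho < 2^-1).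
Hypotheses (theta_gt : 2^-1 < theta) (theta_le1 : theta <= 1).
Hypotheses (s_ge0 : 0 <= s) (g_gt0 : 0 < g) (g_le1 : g <= 1) (kappa_gt0 : 0 < kappa).

Lemma measurable_bessel : measurable_fun setT
  (fun xi : plane R => (1 + enorm xi ^+ 2) `^ (s / 2)).
Proof.
apply: (measurableT_comp (measurable_powR (s / 2))).
by apply: measurable_funD => //; apply: measurable_funX; exact: measurable_enorm.
Qed.

(** The bound is shown up to an arbitrary [e > 0]: a large enough radius [n] makes both the
    truncation error and the [L^2] distance to [V0] contribute at most [e / 2]. *)
Lemma energy_le (U0 V0 Vt : plane R -> C4 R) (t a1 a2 : R) : 0 <= t ->
  in_L1w g U0 -> is_fourier U0 V0 -> measurable_C4 Vt ->
  {ae leb2 R, forall xi, cnorm4 (Vt xi) ^+ 2 <=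
    3 * expR (- (kappa * (enorm xi ^+ 2 / damping rho theta (enorm xi)) * t))
      * cnorm4 (V0 xi) ^+ 2} ->
  (\int[leb2 R]_xi (low_weight s (kappa / 2) (2 - 2 * rho) t xi)%:E <= a1%:E)%E ->
  (\int[leb2 R]_xi (low_weight (s + g) (kappa / 2) (2 - 2 * rho) t xi)%:E <= a2%:E)%E ->
  (\int[leb2 R]_xi ((enorm xi `^ s * cnorm4 (Vt xi)) ^+ 2)%:E <=
    (12 * cnorm4 (integral_C4 setT U0) ^+ 2 * a1 + 1728 * fine (L1w_norm g U0) ^+ 2 * a2)%:E
    + (3 * expR (- (kappa / 2 * t)))%:E *
      \int[leb2 R]_xi (((1 + enorm xi ^+ 2) `^ (s / 2) * cnorm4 (V0 xi)) ^+ 2)%:E)%E.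
Proof.
move=> t0 U0L1 [[mU0 _] [mV0 _] cV] mVt decay A1 A2.
have TF := trunc_fourier_le g_gt0 g_le1 U0L1.
move: (cnorm4 (integral_C4 setT U0)) (fine (L1w_norm g U0)) TF => P M TF.
have a10 : 0 <= a1.
  rewrite -lee_fin; apply: le_trans A1; apply: integral_ge0 => xi _.
  by rewrite lee_fin low_weight_ge0.
apply/lee_addgt0Pr => e e0.
have c0 : 0 <= 192 * M ^+ 2 * a1 by apply: mulr_ge0 a10; apply: mulr_ge0 (ler0n _ _) (sqr_ge0 _).
(* The added 1 keeps the divisor positive when [M] or [a1] is zero. Below, [ep ^+ 2 <= ep] reduces
   the quadratic error to a linear one. *)
have d0 : 0 < 2 * (192 * M ^+ 2 * a1 + 1) by rewrite mulr_gt0 ?ltr0n // ltr_wpDl ?c0 ?ltr01.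
have [N1 HN1] := powRN_small g_gt0 (divr_gt0 e0 d0).
(* The [L^2] error enters with the factor 6, so this leaves [e / 2]. *)
have e12 : 0 < e / 12 by rewrite divr_gt0.
have [N2 HN2] := wL2int_small cV (etrans (sqrtr_gt0 _) e12).
pose n := maxn N1 N2.
pose ep : R := (1 + n%:R) `^ (- g).
have ep0 : 0 <= ep := powR_ge0 _ _.
have ep1 : ep <= 1.
  rewrite /ep powRN invf_le1 ?powR_gt0 ?ltr_pwDl //.
  by rewrite -[leLHS](powRr0 (1 + n%:R)) ler_powR ?(ltW g_gt0) // lerDl.
have epM : 192 * ep ^+ 2 * M ^+ 2 * a1 <= e / 2.
  have := HN1 n (leq_maxl _ _); rewrite -/ep ler_pdivlMr // => H.
  have : ep ^+ 2 <= ep by rewrite expr2 ler_piMl.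
  move=> H2; have := ler_wpM2l c0 H2; nra.
have small : (\int[leb2 R]_x ((1 * cnorm4 (trunc_fourier n U0 x - V0 x)) ^+ 2)%:E
    <= (e / 12)%:E)%E.
  by have := HN2 n (leq_maxr _ _); rewrite sqr_sqrtr ?(ltW e12).
have m1 : measurable_fun setT (cst 1 : plane R -> R) by [].
have mdiff := measurable_C4B (measurable_trunc_fourier n mU0) mV0.
have mE (w : plane R -> R) f : measurable_fun setT w -> measurable_C4 f ->
    measurable_fun setT (fun xi => (w xi * cnorm4 (f xi)) ^+ 2).
  by move=> mw mf; apply/measurable_EFinP; exact: measurable_wL2.
have := @ae_integral_lin4_le R _ _ (leb2 R)
  (fun xi => (enorm xi `^ s * cnorm4 (Vt xi)) ^+ 2)
  (low_weight s (kappa / 2) (2 - 2 * rho) t)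
  (low_weight (s + g) (kappa / 2) (2 - 2 * rho) t)
  (fun xi => (1 * cnorm4 (trunc_fourier n U0 xi - V0 xi)) ^+ 2)
  (fun xi => ((1 + enorm xi ^+ 2) `^ (s / 2) * cnorm4 (V0 xi)) ^+ 2)
  (12 * P ^+ 2 + 192 * ep ^+ 2 * M ^+ 2) (1728 * M ^+ 2) 6 (3 * expR (- (kappa / 2 * t)))
  (mE _ _ (measurable_enorm_powR s) mVt) (measurable_low_weight _ _ _ _)
  (measurable_low_weight _ _ _ _) (mE _ _ m1 mdiff) (mE _ _ measurable_bessel mV0)
  (fun _ => sqr_ge0 _) (low_weight_ge0 _ _ _ _) (low_weight_ge0 _ _ _ _)
  (fun _ => sqr_ge0 _) (fun _ => sqr_ge0 _).
have q1 : 0 <= 12 * P ^+ 2 + 192 * ep ^+ 2 * M ^+ 2.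
  apply: addr_ge0; apply: mulr_ge0; rewrite ?ler0n ?sqr_ge0 //.
  by apply: mulr_ge0 (ler0n _ _) (sqr_ge0 _).
have q2 : 0 <= 1728 * M ^+ 2 by exact: mulr_ge0 (ler0n _ _) (sqr_ge0 _).
have q4 : 0 <= 3 * expR (- (kappa / 2 * t)) by rewrite mulr_ge0 ?expR_ge0.
move=> /(_ q1 q2 (ler0n _ 6) q4) lin4.
apply: le_trans (lin4 _) _; clear lin4.
  apply: filterS decay => xi dxi.
  exact: (energy_pointwise rho_ge0 rho_lt theta_gt theta_le1 s_ge0 g_gt0 kappa_gt0
    t0 dxi (TF n xi)).
move: A1 A2 small; set I1 := integral _ _ _; set I2 := integral _ _ _.
set I3 := integral _ _ _; set I4 := integral _ _ _ => A1 A2 small.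
rewrite -[leRHS]addeA [X in (_ <= _ + X)%E]addeC addeA.
apply: leeD => //.
apply: (@le_trans _ _ (((12 * P ^+ 2 + 192 * ep ^+ 2 * M ^+ 2) * a1)%:E
  + (1728 * M ^+ 2 * a2)%:E + (6 * (e / 12))%:E)%E).
  have mul (c x : R) (I : \bar R) : 0 <= c -> (I <= x%:E -> c%:E * I <= (c * x)%:E)%E.
    by move=> c1 Ix; rewrite EFinM; apply: lee_wpmul2l; rewrite ?lee_fin.
  by apply: leeD; [apply: leeD; apply: mul | exact: mul (ler0n _ 6) small].
rewrite -!EFinD lee_fin; lra.
Qed.
End EnergyIntegral.

(** * Choice of the constant and return from squared norms to norms *)

Theorem theorem3p2 (R : realType) (a b rho theta s gamma : R)
    (a_gt0 : 0 < a) (ab : a < b)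
    (rho_ge0 : 0 <= rho) (rho_lt : rho < 2^-1)
    (theta_gt : 2^-1 < theta) (theta_le1 : theta <= 1)
    (s_ge0 : 0 <= s) (gamma_gt0 : 0 < gamma) (gamma_le1 : gamma <= 1) :
  exists C : R, 0 < C /\
    forall (U0 : plane R -> C4 R) (U : R -> plane R -> C4 R),
      in_Hs s U0 -> in_L1w gamma U0 ->
      is_solution a b rho theta U0 U ->
      forall t : R, 0 <= t ->
        (dotHs_norm s (U t) <=
           (C * (1 + t) `^ (- ((s + gamma) / (2 - 2 * rho))
                            - 1 / (2 - 2 * rho)))%:E
             * (Hs_norm s U0 + L1w_norm gamma U0)
           + (C * (1 + t) `^ (- (s / (2 - 2 * rho)) - 1 / (2 - 2 * rho))
              * cnorm4 (integral_C4 setT U0))%:E)%E.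
Proof.
have [kappa kappa0 decay] := ode_decay a_gt0 ab rho_ge0 rho_lt theta_gt.
set m := 2 - 2 * rho.
have m1 : 1 < m by rewrite /m; lra.
have k0 : 0 < kappa / 2 by rewrite divr_gt0.
have sg0 : 0 <= s + gamma by rewrite addr_ge0 // ltW.
have [K1 K10 A1] := low_weight_integral_le s_ge0 k0 m1.
have [K2 K20 A2] := low_weight_integral_le sg0 k0 m1.
have m0 : 0 < m by apply: lt_trans m1.
(* Twice the rate of the first term, so that the high-frequency remainder is absorbed into it after
   squaring. *)
have p0 : 0 <= 2 * ((s + gamma) / m + 1 / m).
  by rewrite mulr_ge0 ?ler0n // addr_ge0 // divr_ge0 ?ler01 // ltW.
have [K3 K30 A3] := expR_le_powR k0 p0.
(* The added 1 gives [C <= C ^+ 2]: the constants of the squared estimate have to be bounded by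
   [C ^+ 2]. *)
pose C := 12 * K1 + 1728 * K2 + 3 * K3 + 1.
have C1 : 1 <= C by rewrite /C; lra.
have C0 : 0 < C by apply: lt_le_trans C1.
have CC : C <= C ^+ 2 by rewrite expr2 ler_peMl // ltW.
have b1 : 12 * K1 <= C ^+ 2 by apply: le_trans CC; rewrite /C; lra.
have b2 : 1728 * K2 <= C ^+ 2 by apply: le_trans CC; rewrite /C; lra.
have b3 : 3 * K3 <= C ^+ 2 by apply: le_trans CC; rewrite /C; lra.
clearbody C.
exists C; split => // U0 U [L2U0 HsU0] L1U0 [U00 [W [fW odeW]]] t t0.
have fW0 : is_fourier U0 (W 0) := is_fourier_ae L2U0 U00 (fW 0 (lexx 0)).
have fU0 := fourierP fW0.
have [_ [mVt _] _] := fourierP (fW t t0).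
have energy : {ae leb2 R, forall xi, cnorm4 (fourier (U t) xi) ^+ 2 <=
    3 * expR (- (kappa * (enorm xi ^+ 2 / damping rho theta (enorm xi)) * t))
      * cnorm4 (fourier U0 xi) ^+ 2}.
  apply: filterS3 odeW (ae_eq_fourier (fW t t0)) (ae_eq_fourier fW0).
  by move=> xi ode -> ->; exact: decay ode t t0.
have E := energy_le rho_ge0 rho_lt theta_gt theta_le1 s_ge0 gamma_gt0 gamma_le1 kappa0
  t0 L1U0 fU0 mVt energy (A1 t t0) (A2 t t0).
have t1 : 0 < 1 + t by rewrite ltr_pwDl.
move: (A3 t t0) E; rewrite -/m.
have sq (p : R) : (1 + t) `^ (2 * p) = ((1 + t) `^ p) ^+ 2.
  by rewrite mulrC powRrM powR_mulrn // powR_ge0.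
have -> : - ((2 * s + 2) / m) = 2 * (- (s / m) - 1 / m) by ring.
have -> : - ((2 * (s + gamma) + 2) / m) = 2 * (- ((s + gamma) / m) - 1 / m) by ring.
have -> : - (2 * ((s + gamma) / m + 1 / m)) = 2 * (- ((s + gamma) / m) - 1 / m) by ring.
rewrite !sq.
have x0 := powR_ge0 (1 + t) (- (s / m) - 1 / m).
have y0 := powR_ge0 (1 + t) (- ((s + gamma) / m) - 1 / m).
(* From here on [y] is the rate with [gamma] and [x] the one without; the squared estimate contains
   only their squares. *)
move: x0 y0; move: (_ `^ _) (_ `^ _) => y x x0 y0.
have [_ M1] := L1U0.
have M0 : (0 <= L1w_norm gamma U0)%E.
  by apply: integral_ge0 => z _; rewrite lee_fin mulr_ge0 ?powR_ge0 ?cnorm4_ge0.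
have H0 : (0 <= Hs_norm s U0)%E by rewrite /Hs_norm wL2normE poweR_ge0.
have HE : Hs_norm s U0 = (fine (Hs_norm s U0))%:E by rewrite fineK // ge0_fin_numE.
have ME : L1w_norm gamma U0 = (fine (L1w_norm gamma U0))%:E by rewrite fineK // ge0_fin_numE.
have Hf0 := fine_ge0 H0; have Mf0 := fine_ge0 M0; have P0 := cnorm4_ge0 (integral_C4 setT U0).
have HI : (\int[leb2 R]_xi (((1 + enorm xi ^+ 2) `^ (s / 2) * cnorm4 (fourier U0 xi)) ^+ 2)%:E
    <= (fine (Hs_norm s U0) ^+ 2)%:E)%E.
  by rewrite -wL2norm_le // -HE.
rewrite HE ME; move: Hf0 Mf0 P0 HI.
move: (fine (Hs_norm s U0)) (fine (L1w_norm gamma U0)) (cnorm4 _) => H M P Hf0 Mf0 P0 HI dec E.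
change (fine M%:E) with M in E.
have -> : ((C * y)%:E * (H%:E + M%:E) + (C * x * P)%:E
  = (C * y * (H + M) + C * x * P)%:E)%E by rewrite [RHS]EFinD [X in _ = (X + _)%E]EFinM EFinD.
rewrite wL2norm_le; last first.
  have C0' := ltW C0.
  by rewrite addr_ge0 // !mulr_ge0 // addr_ge0.
apply: (le_trans E).
have e0 := expR_ge0 (- (kappa / 2 * t)).
apply: (@le_trans _ _ ((12 * P ^+ 2 * (K1 * x ^+ 2) + 1728 * M ^+ 2 * (K2 * y ^+ 2))%:E
   + (3 * expR (- (kappa / 2 * t)))%:E * (H ^+ 2)%:E)%E).
  by apply: leeD => //; apply: lee_wpmul2l.
rewrite -EFinM -EFinD lee_fin.
have xP : 0 <= x ^+ 2 * P ^+ 2 by rewrite mulr_ge0 ?sqr_ge0.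
have yM : 0 <= y ^+ 2 * M ^+ 2 by rewrite mulr_ge0 ?sqr_ge0.
have yH : 0 <= y ^+ 2 * H ^+ 2 by rewrite mulr_ge0 ?sqr_ge0.
(* All mixed products are nonnegative, so the square of the sum dominates the sum of the squares. *)
have cross : C ^+ 2 * (x ^+ 2 * P ^+ 2 + y ^+ 2 * M ^+ 2 + y ^+ 2 * H ^+ 2)
    <= (C * y * (H + M) + C * x * P) ^+ 2.
  have -> : (C * y * (H + M) + C * x * P) ^+ 2
    = C ^+ 2 * (x ^+ 2 * P ^+ 2 + y ^+ 2 * M ^+ 2 + y ^+ 2 * H ^+ 2)
      + 2 * C ^+ 2 * (y ^+ 2 * (H * M) + (y * H + y * M) * (x * P)) by ring.
  rewrite lerDl; apply: mulr_ge0; first by apply: mulr_ge0 (ler0n _ _) (sqr_ge0 _).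
  by rewrite addr_ge0 // ?mulr_ge0 ?sqr_ge0 ?addr_ge0 ?mulr_ge0.
apply: le_trans cross.
have dH : expR (- (kappa / 2 * t)) * H ^+ 2 <= K3 * y ^+ 2 * H ^+ 2.
  by rewrite ler_wpM2r ?sqr_ge0.
have := ler_wpM2r xP b1; have := ler_wpM2r yM b2; have := ler_wpM2r yH b3.
clear -dH; lra.
Qed.
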